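(* Let $t$ be a positive integer and let $\epsilon>0$. There is a randomized algorithm that, given matrices $A,P\in \mathrm{GF}(2)^{r\times n}$ where $A$ is the incidence matrix of a graph and $\operatorname{rank}(P)\le t$, will, with probability at least $1-\epsilon$, correctly compute the cogirth of $M(A+P)$ in time $O(r^5 n)$.
   Context: For a matrix $A$ over $\mathrm{GF}(2)$ with column set $E$, $M(A)$ denotes the binary matroid on $E$ represented by $A$. A cocycle of $M(A)$ is a subset of $E$ whose characteristic vector lies in the row space of $A$ (equivalently, a cycle of the dual matroid). The cogirth of $M(A)$ is the size of its smallest non-empty cocycle (the girth of the dual), and is $\infty$ if there is none. The incidence matrix of a graph (over $\mathrm{GF}(2)$) has rows indexed by vertices and columns by edges, with entry $1$ exactly when the vertex is an end of the (non-loop) edge. Here $t$ and $\epsilon$ are fixed, so the constants in the $O$-notation may depend on them. *)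

(* Defs.v *)
From HB Require Import structures.
From mathcomp Require Import all_boot all_order all_algebra.
From mathcomp Require Import reals.

Set Implicit Arguments.
Unset Strict Implicit.
Unset Printing Implicit Defensive.

Import Order.TTheory GRing.Theory Num.Theory.

(** * Graphs and binary matroids *)

(* Loops and parallel edges are allowed; a loop is an edge with one end. *)
Record graph (V E : finType) := Graph {
  ends : E -> {set V};
  card_ends : forall e, 0 < #|ends e| <= 2
}.

Definition is_loop (V E : finType) (G : graph V E) (e : E) : bool :=
  #|ends G e| == 1.

Definition incidence_mx (r n : nat) (G : graph 'I_r 'I_n) : 'M['F_2]_(r, n) :=
  \matrix_(v, e) (~~ is_loop G e && (v \in ends G e))%:R%R.

Definition is_incidence_mx (r n : nat) (A : 'M['F_2]_(r, n)) : Prop :=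
  exists G : graph 'I_r 'I_n, A = incidence_mx G.

Definition char_vec (n : nat) (X : {set 'I_n}) : 'rV['F_2]_n :=
  \row_e (e \in X)%:R%R.

(* [cocycle A X]: X is a cocycle of the binary matroid M(A). *)
Definition cocycle (r n : nat) (A : 'M['F_2]_(r, n)) (X : {set 'I_n}) : bool :=
  (char_vec X <= A)%MS.

(* The cogirth of M(A); [None] stands for infinity. *)
Definition cogirth (r n : nat) (A : 'M['F_2]_(r, n)) : option nat :=
  if [pick X | (X != set0) && cocycle A X] is Some X0
  then Some #|[arg min_(X < X0 | (X != set0) && cocycle A X) #|X| ]|
  else None.

(** * A randomized word RAM with structured control flow *)

Definition memory := nat -> nat.

Inductive binop := Add | Sub | Mul | Div | Eq | Lt.

(* [Read a] is the content of the cell whose address is the value of [a]. *)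
Inductive expr :=
| Const of nat
| Read of expr
| Bin of binop & expr & expr.

(* [Store a e] writes the value of [e] in the cell addressed by [a];
   [Draw a e] writes there a uniformly random element of {0, ..., e}. *)
Inductive cmd :=
| Skip
| Store of expr & expr
| Draw of expr & expr
| Seq of cmd & cmd
| If of expr & cmd & cmd
| While of expr & cmd.

Definition eval_binop (o : binop) (x y : nat) : nat :=
  match o with
  | Add => x + y
  | Sub => x - y
  | Mul => x * y
  | Div => x %/ y
  | Eq => x == y
  | Lt => x < y
  end.

Fixpoint eval (m : memory) (e : expr) : nat :=
  match e with
  | Const k => k
  | Read a => m (eval m a)
  | Bin o e1 e2 => eval_binop o (eval m e1) (eval m e2)
  end.

Definition update (m : memory) (a v : nat) : memory :=
  fun b => if b == a then v else m b.

(* The commands that remain to be executed, and the memory. *)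
Definition state := (seq cmd * memory)%type.

(* The equally likely successors of a state. One step is one unit of time; as
   a program is a fixed finite object, each of its expressions is evaluated
   with a bounded number of word operations. Cell contents and cell addresses
   are words, i.e. less than W: an attempt to write anything else crashes the
   machine, leaving it without a successor. *)
Definition step (W : nat) (s : state) : seq state :=
  let: (k, m) := s in
  match k with
  | [::] => [::]
  | Skip :: k' => [:: (k', m)]
  | Store a e :: k' =>
      if (eval m a < W) && (eval m e < W)
      then [:: (k', update m (eval m a) (eval m e))] else [::]
  | Draw a e :: k' =>
      if (eval m a < W) && (eval m e < W)
      then [seq (k', update m (eval m a) v) | v <- iota 0 (eval m e).+1]
      else [::]
  | Seq c1 c2 :: k' => [:: (c1 :: c2 :: k', m)]
  | If e c1 c2 :: k' => [:: ((if eval m e != 0 then c1 else c2) :: k', m)]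
  | While e c :: k' =>
      [:: (if eval m e != 0 then c :: While e c :: k' else k', m)]
  end.

(* The probability that, started in state s, the machine halts normally (all
   commands executed) after at most T steps, in a memory satisfying Q. *)
Fixpoint halt_prob (R : realType) (W T : nat) (s : state)
    (Q : pred memory) : R :=
  (if nilp s.1 then (Q s.2)%:R
   else if T is T'.+1 then
     let succs := step W s in
     (\sum_(s' <- succs) halt_prob R W T' s' Q) / (size succs)%:R
   else 0)%R.

Definition mx_entries (r n : nat) (A : 'M['F_2]_(r, n)) : seq nat :=
  [seq nat_of_bool (A i j != 0%R) | i <- enum 'I_r, j <- enum 'I_n].

(* The input (A, P) is stored from address 0 on, as r, n, and the entries of A
   and of P in row-major order; all other cells contain 0. *)
Definition input_memory (r n : nat) (A P : 'M['F_2]_(r, n)) : memory :=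
  nth 0 ([:: r; n] ++ mx_entries A ++ mx_entries P).

(* The answer is read in cell 0. As no nonempty set has size 0, the value 0 is
   free to encode infinity. *)
Definition output (m : memory) : option nat :=
  if m 0 is g.+1 then Some g.+1 else None.

(* Main.v *)
Require Import Defs.
From HB Require Import structures.
From mathcomp Require Import all_boot all_order all_algebra.
From mathcomp Require Import zify ring lra.
From mathcomp Require Import boolp reals.

Set Implicit Arguments.
Unset Strict Implicit.
Unset Printing Implicit Defensive.

Import Order.TTheory GRing.Theory Num.Theory.

(* Karger's random contraction, run on the binary matroid M(A+P) as a Gaussian
   elimination whose pivot columns are drawn uniformly among the nonzero
   columns: contracting an element keeps the vectors of the row space that
   vanish on it, and these are spanned by the rows below the pivot. A fixed
   lightest nonzero vector x, of weight g, survives unless a pivot column lies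
   in its support. When the rank is d and N columns are nonzero, 3g <= 2N if
   d >= 2 (binary matroids), and (d - c)g <= 4N for c = 2^(t+1) + t: up to t
   dimensions, the row space is spanned by the cuts of a graph that are balanced
   for a vertex labelling with 2^t labels, so pairing vertices with equal labels
   gives many vectors of the row space that together use each edge at most
   twice. Hence x survives the passage from rank d to rank s with probability
   at least of the order of (s/d)^4.
   A run down to rank 1 costs O(r^2 n) and succeeds with probability 1/r^4, which
   would give O(r^6 n). So r^2 outer runs each contract to rank about sqrt r,
   with success probability 1/r^2, and each of them is followed by r^2 inner runs
   on the remaining sqrt r rows, costing O(r n) each and succeeding with
   probability 1/r^2. As elimination preserves the row space, all the runs work
   in place, and no input is ever copied. *)

(** * Light vectors of perturbed cut spaces *)

Section BinaryCodes.
Local Open Scope ring_scope.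

Lemma F2_neq0 (x : 'F_2) : (x != 0) = (x == 1).
Proof. by case: x => [[|[|]]]. Qed.

Lemma F2_addxx (x : 'F_2) : x + x = 0.
Proof. by apply/eqP; case: x => [[|[|]]]. Qed.

Lemma F2_add_neq0 (x y : 'F_2) : (x + y != 0) = (x != 0) (+) (y != 0).
Proof. by case: x => [[|[|]]] //; case: y => [[|[|]]]. Qed.

Definition wt n (v : 'rV['F_2]_n) : nat := #|[set e | v 0 e != 0]|.

Definition nzcols m n (V : 'M['F_2]_(m, n)) : {set 'I_n} := [set e | col e V != 0].

Lemma nzcolsP m n (V : 'M['F_2]_(m, n)) e :
  reflect (exists i, V i e != 0) (e \in nzcols V).
Proof.
rewrite inE; apply: (iffP idP) => [/cV0Pn [i]|[i Vi]].
  by rewrite mxE; exists i.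
by apply/cV0Pn; exists i; rewrite mxE.
Qed.

Lemma nzcols_sub m1 m2 n (V : 'M['F_2]_(m1, n)) (V' : 'M_(m2, n)) :
  (V <= V')%MS -> nzcols V \subset nzcols V'.
Proof.
case/submxP=> D ->; apply/subsetP => e; rewrite !inE; apply: contra => /eqP V0.
by rewrite colE -mulmxA -colE V0 mulmx0.
Qed.

Lemma nzcols_mem m n (V : 'M['F_2]_(m, n)) (v : 'rV_n) e :
  (v <= V)%MS -> v 0 e != 0 -> e \in nzcols V.
Proof.
by move=> /nzcols_sub/subsetP sV ve; apply: sV; apply/nzcolsP; exists 0.
Qed.

Lemma wt_gt0 n (v : 'rV['F_2]_n) : (0 < wt v)%N = (v != 0).
Proof.
apply/card_gt0P/rV0Pn => [[e]|[e ve]]; first by rewrite inE; exists e.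
by exists e; rewrite inE.
Qed.

(** The cocycle space of the contraction of [e], kept in the same coordinate space so that
    contractions can be iterated without reindexing. *)
Definition contr m n (V : 'M['F_2]_(m, n)) (e : 'I_n) : 'M['F_2]_n :=
  (V :&: kermx (delta_mx e 0 : 'cV_n))%MS.

Lemma sub_contr m n (V : 'M['F_2]_(m, n)) e (v : 'rV_n) :
  (v <= contr V e)%MS = (v <= V)%MS && (v 0 e == 0).
Proof.
rewrite sub_capmx; congr (_ && _).
apply/sub_kermxP/eqP; rewrite -colE.
  by move=> /matrixP/(_ 0 0); rewrite !mxE.
by move=> ve; apply/matrixP => i j; rewrite !mxE !ord1.
Qed.

Lemma contr_sub m n (V : 'M['F_2]_(m, n)) e : (contr V e <= V)%MS.
Proof. exact: capmxSl. Qed.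

Lemma rank_contr m n (V : 'M['F_2]_(m, n)) e :
  e \in nzcols V -> \rank V = (\rank (contr V e)).+1.
Proof.
rewrite inE => Ve; rewrite -(mxrank_mul_ker V (delta_mx e 0 : 'cV_n)) -colE.
by rewrite -[\rank (col e V)]mxrank_tr rank_rV trmx_eq0 Ve.
Qed.

(* Each nonzero column is met by exactly two of [x], [v] and [x + v], or by
   none of them. *)
Lemma three_wt_le m n (V : 'M['F_2]_(m, n)) (g : nat) (x : 'rV_n) :
  (forall v : 'rV_n, (v <= V)%MS -> v != 0 -> (g <= wt v)%N) ->
  (x <= V)%MS -> x != 0 -> (1 < \rank V)%N -> (3 * g <= 2 * #|nzcols V|)%N.
Proof.
move=> gmin xV x0 rkV.
(* Rank at least 2 leaves a row outside the span of [x], so [x], [v] and [x + v] are three nonzero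
   vectors. *)
have /row_subPn [i iV] : ~~ (V <= x)%MS.
  by apply: contraL rkV => /mxrankS; rewrite rank_rV x0; lia.
set v := row i V in iV; have vV : (v <= V)%MS by exact: row_sub.
have v0 : v != 0 by apply: contraNneq iV => ->; rewrite sub0mx.
have xv0 : x + v != 0.
  apply: contraNneq iV => /eqP; rewrite addr_eq0 => /eqP ->.
  by rewrite (eqmx_opp v).
have xvV : ((x + v)%R <= V)%MS by exact: addmx_sub.
have := gmin _ xV x0; have := gmin _ vV v0; have := gmin _ xvV xv0.
suff : (wt x + wt v + wt (x + v)%R <= 2 * #|nzcols V|)%N by lia.
have wtE (w : 'rV_n) : (w <= V)%MS -> wt w = (\sum_(e in nzcols V) (w 0%R e != 0%R))%N.
  move=> wV; rewrite /wt -sum1_card big_mkcond [RHS]big_mkcond.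
  apply: eq_bigr => e _; rewrite !inE; case: ifP => [we|/negbFE we].
    by have := nzcols_mem wV we; rewrite inE => ->.
  by rewrite if_same.
rewrite !wtE // -!big_split /= mulnC -sum_nat_const.
apply: leq_sum => e _; rewrite [(x + v)%R _ _]mxE F2_add_neq0.
by case: (x 0 e != 0); case: (v 0 e != 0).
Qed.

End BinaryCodes.

(** * Labelled graphs under contraction *)

Section PerturbedGraphic.
Local Open Scope ring_scope.

(* [kermx U *m B] is the space of the cuts of a graph, whose vertices index the
   rows of [B], that are balanced for the vertex labelling [U]. *)
Definition perturbed_graphic t m n (V : 'M['F_2]_(m, n)) : Prop :=
  exists q (B : 'M['F_2]_(q, n)) (U : 'M['F_2]_(q, t)),
  [/\ forall e, (#|[set i | B i e != 0%R]| <= 2)%N,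
      (kermx U *m B <= V)%MS &
      (\rank V <= \rank (kermx U *m B) + t)%N].

Lemma perturbed_graphic_eqmx t m1 m2 n (V : 'M_(m1, n)) (V' : 'M_(m2, n)) :
  (V :=: V')%MS -> perturbed_graphic t V -> perturbed_graphic t V'.
Proof.
move=> eqV [q [B [U [B2 sV rV]]]]; exists q, B, U; split=> //.
  by rewrite -eqV.
by rewrite -eqV.
Qed.

Lemma sub_kermx_mulP q t n (B : 'M['F_2]_(q, n)) (U : 'M_(q, t)) (v : 'rV_n) :
  reflect (exists2 z : 'rV_q, z *m U = 0 & v = z *m B) (v <= kermx U *m B)%MS.
Proof.
apply: (iffP submxP) => [[D ->]|[z zU ->]].
  exists (D *m kermx U); last by rewrite mulmxA.
  by rewrite -mulmxA mulmx_ker mulmx0.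
have /submxP [D ->] : (z <= kermx U)%MS by apply/sub_kermxP.
by exists D; rewrite mulmxA.
Qed.

(** Row [i], with a 1 in column [e], is added to every row with a 1 there, itself included: vertex
    [i] is merged into the other end of [e] and its own row becomes 0. Labels are added likewise.
    Coefficients [z] for the new pair then act as [z] for the old one, corrected at [i] so that the
    combination vanishes at [e]. *)
Lemma contr_kermx_mul q t n (B : 'M['F_2]_(q, n)) (U : 'M_(q, t)) e :
  (forall e, (#|[set i | B i e != 0%R]| <= 2)%N) ->
  exists (B' : 'M['F_2]_(q, n)) (U' : 'M['F_2]_(q, t)),
    (forall e, (#|[set i | B' i e != 0%R]| <= 2)%N) /\
    (kermx U' *m B' :=: contr (kermx U *m B) e)%MS.
Proof.
move=> B2.
have [/existsP [i Bie]|/existsPn B0] := boolP [exists i, B i e != 0]; last first.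
  exists B, U; split=> //; apply/eqmxP/andP; split; last exact: contr_sub.
  apply/rV_subP => v vB; rewrite sub_contr vB; case/sub_kermx_mulP: vB => z _ ->.
  rewrite mxE big1 // => k _.
  by have := B0 k; rewrite negbK => /eqP ->; rewrite mulr0.
have Bie1 : B i e = 1 by apply/eqP; rewrite -F2_neq0.
pose B' := B + col e B *m row i B; pose U' := U + col e B *m row i U.
have zE p (X : 'M['F_2]_(q, p)) (z : 'rV_q) :
    z *m (X + col e B *m row i X) = z *m X + (z *m B) 0 e *: row i X.
  rewrite mulmxDr mulmxA; congr (_ + _).
  by rewrite [z *m col e B]mx11_scalar mul_scalar_mx colE mulmxA -colE mxE.
exists B', U'; split.
  move=> b; have [Bib|Bib] := eqVneq (B i b) 0.
    rewrite (_ : [set k | _] = [set k | B k b != 0]) //.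
    by apply/setP => k; rewrite !inE !mxE big_ord1 !mxE Bib mulr0 addr0.
  have Bib1 : B i b = 1 by apply/eqP; rewrite -F2_neq0.
  (* Columns [b] and [e] both meet row [i], so each has at most one other 1; the new column [b] is
     supported on those. *)
  pose T b := [set k | B k b != 0] :\ i.
  have T1 c : B i c != 0 -> (#|T c| <= 1)%N.
    move=> ic; have := B2 c; rewrite (cardsD1 i) inE ic; rewrite /T; lia.
  apply: (@leq_trans #|T b :|: T e|); last first.
    by rewrite (leq_trans (leq_card_setU _ _)) //; have := T1 _ Bib; have := T1 _ Bie; lia.
  apply/subset_leq_card/subsetP => k; rewrite !inE !mxE big_ord1 !mxE Bib1 mulr1.
  rewrite F2_add_neq0; case: (eqVneq k i) => [->|_] /=; first by rewrite Bib Bie.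
  by case: (B k b != 0); case: (B k e != 0).
apply/eqmxP/andP; split; apply/rV_subP => v.
  case/sub_kermx_mulP => z; rewrite !zE => zU ->.
  rewrite sub_contr; apply/andP; split.
    apply/sub_kermx_mulP; exists (z + (z *m B) 0 e *: delta_mx 0 i).
      by rewrite mulmxDl -scalemxAl -rowE.
    by rewrite mulmxDl -scalemxAl -rowE.
  by rewrite !mxE Bie1 mulr1 F2_addxx.
rewrite sub_contr => /andP [/sub_kermx_mulP [z zU ->] /eqP ze].
by apply/sub_kermx_mulP; exists z; rewrite zE ze scale0r addr0.
Qed.

(** The rank deficit does not grow: with [X] the space of balanced cuts, the dimension formula
    bounds the sum of the ranks of [contr V e] and [X] by that of the ranks of [V] and
    [contr X e]. *)
Lemma perturbed_graphic_contr t m n (V : 'M_(m, n)) e :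
  perturbed_graphic t V -> perturbed_graphic t (contr V e).
Proof.
move=> [q [B [U [B2 sV rV]]]].
have [B' [U' [B2' eqB]]] := contr_kermx_mul U e B2.
exists q, B', U'; split=> //.
  by rewrite eqB capmxS.
rewrite eqB; set X := (kermx U *m B) in sV rV eqB *.
have := mxrank_sum_cap (contr V e) X.
have : (\rank (contr V e + X)%MS <= \rank V)%N.
  by apply: mxrankS; rewrite addsmx_sub contr_sub.
have : (\rank (contr V e :&: X)%MS <= \rank (contr X e))%N.
  apply: mxrankS; rewrite sub_capmx capmxSr.
  by apply: submx_trans (capmxSl _ _) _; exact: capmxSr.
lia.
Qed.

(** Coefficients annihilating [U], where P = UY and [U] has [t] columns, combine the rows of [A] and
    of [A + P] to the same vector, and they have codimension at most [t]. *)
Lemma perturbed_graphicD r n (A P : 'M['F_2]_(r, n)) t :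
  is_incidence_mx A -> (\rank P <= t)%N -> perturbed_graphic t (A + P)%R.
Proof.
move=> [G AE] rP.
have [U [Y PE]] : exists (U : 'M['F_2]_(r, t)) (Y : 'M_(t, n)), P = U *m Y.
  (* The rank factorization of [P], padded with zeros to inner dimension [t]. *)
  exists (col_base P *m pid_mx (\rank P)), (pid_mx (\rank P) *m row_base P).
  rewrite mulmxA -(mulmxA (col_base P)) mul_pid_mx minnn (minn_idPr rP).
  by rewrite pid_mx_1 mulmx1 mulmx_base.
have kE : kermx U *m (A + P) = kermx U *m A.
  by rewrite mulmxDr PE mulmxA mulmx_ker mul0mx addr0.
exists r, A, U; split.
- move=> e; have /andP [_] := card_ends G e; apply: leq_trans.
  apply/subset_leq_card/subsetP => v; rewrite !inE AE mxE.
  by case: (v \in ends G e); rewrite // andbF eqxx.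
- by rewrite -kE submxMl.
rewrite -kE; have := mxrank_mul_min (kermx U) (A + P).
by rewrite mxrank_ker; have := rank_leq_col U; have := rank_leq_row U; lia.
Qed.

(* Two vertices with the same label bound a cut that lies in [V]; summing the
   degrees over all these pairs bounds the number of edges from below. *)
Lemma min_wt_le t m n (V : 'M['F_2]_(m, n)) (g : nat) :
  perturbed_graphic t V ->
  (forall v : 'rV_n, (v <= V)%MS -> v != 0 -> (g <= wt v)%N) ->
  ((\rank V - (2 ^ t.+1 + t)) * g <= 4 * #|nzcols V|)%N.
Proof.
move=> [q [B [U [B2 sV rV]]]] gmin.
have [N NE] : exists N, N = nzcols V by eexists.
(* Balanced cuts vanish outside [N], so degrees are counted inside [N], and vertices of degree 0 add
   nothing to the rank. *)
pose E i := [set e in N | B i e != 0]; pose I1 := [set i | E i != set0].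
have zB0 (v : 'rV_n) e : (v <= kermx U *m B)%MS -> e \notin N -> v 0 e = 0.
  move=> vB eN; apply/eqP/negbNE; apply: contra eN; rewrite NE; apply: nzcols_mem.
  exact: submx_trans sV.
have rkB : (\rank (kermx U *m B) <= #|I1|)%N.
  pose BN := \matrix_(i, e) (if e \in N then B i e else 0).
  apply: (@leq_trans (\rank (rowsub (enum_val : 'I_#|I1| -> 'I_q) BN))); last first.
    exact: rank_leq_row.
  apply/mxrankS; apply: (@submx_trans _ _ _ _ _ _ BN).
    apply/rV_subP => v vB; have /sub_kermx_mulP [z _ vE] := vB.
    apply/submxP; exists z; apply/rowP => e.
    have [eN|eN] := boolP (e \in N); last first.
      by rewrite zB0 // mxE big1 // => k _; rewrite mxE (negPf eN) mulr0.
    by rewrite vE !mxE; apply: eq_bigr => k _; rewrite mxE eN.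
  apply/row_subP => i; have [iI|] := boolP (i \in I1).
    apply/(eq_row_sub (enum_rank_in iI i)); apply/rowP => e.
    by rewrite !mxE enum_rankK_in.
  rewrite inE negbK => /eqP Ei; rewrite (_ : row i BN = 0) ?sub0mx //.
  apply/rowP => e; rewrite !mxE; case: ifP => // eN.
  have /setP/(_ e) := Ei; rewrite !inE eN /= => /negbFE/eqP //.
pose d i := #|E i|.
have dsum : (\sum_(i in I1) d i <= 2 * #|N|)%N.
  apply: (@leq_trans (\sum_i \sum_(e in N) (B i e != 0%R))%N).
    rewrite big_mkcond /=; apply: leq_sum => i _; case: ifP => // _.
    rewrite /d -sum1_card big_mkcond [X in (_ <= X)%N]big_mkcond.
    by apply: leq_sum => e _; rewrite !inE; case: (e \in N); case: (B i e != 0).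
  rewrite exchange_big /= mulnC -sum_nat_const; apply: leq_sum => e _.
  apply: leq_trans (B2 e); rewrite -sum1_card [X in (_ <= X)%N]big_mkcond.
  by apply: leq_sum => i _; rewrite inE; case: (B i e != 0).
pose L (a : 'rV['F_2]_t) := [set i in I1 | row i U == a].
(* Each of the M vertices with label [a] has at least M - 2 partners with which it bounds a nonempty
   cut. Adding up the inequalities [g <= d i + d j] gives M(M - 2)g <= (2M - 2)Sd, and M cancels. *)
have Lsum (a : 'rV_t) : (g * (#|L a| - 2) <= 2 * \sum_(i in L a) d i)%N.
  set M := #|L a|; set Sd := (\sum_(i in L a) d i)%N.
  have pair i : i \in L a -> (g * (M - 2) <= (M - 1) * d i + (Sd - d i))%N.
    move=> iL; have iI : i \in I1 by move: iL; rewrite inE => /andP [].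
    have Ui : row i U = a by move: iL; rewrite inE => /andP [_ /eqP].
    (* The partners whose cut with [i] is empty. There is at most one: an edge at [i], [j] and [j']
       would have three ends. *)
    pose Z := [set j in L a :\ i | E i == E j].
    have Z1 : (#|Z| <= 1)%N.
      apply/card_le1_eqP => j j'; rewrite !inE.
      case/andP=> /and3P [ji _ _] /eqP Ej /andP [/and3P [j'i _ _] /eqP Ej'].
      have /set0Pn [e eE] : E i != set0 by move: iI; rewrite inE.
      have [//|jj'] := eqVneq j j'.
      have := B2 e; rewrite leqNgt => /negP [].
      apply: (@leq_trans #|[set i; j; j']|).
        by rewrite -setUA cardsU1 cards2 !inE negb_or eq_sym ji eq_sym j'i jj'.
      apply/subset_leq_card/subsetP => k; rewrite !inE.
      have inE' (l : 'I_q) : e \in E l -> B l e != 0 by rewrite inE => /andP [].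
      case/orP => [/orP [] |] /eqP ->; apply: inE' => //.
        by rewrite -Ej.
      by rewrite -Ej'.
    have good j : j \in L a :\ i -> j \notin Z -> (g <= d i + d j)%N.
      move=> jL jZ; have EE : E i != E j.
        by apply: contra jZ => EE; rewrite inE jL.
      have Uj : row j U = a by move: jL; rewrite !inE => /and3P [_ _ /eqP].
      pose v : 'rV_n := (delta_mx 0 i + delta_mx 0 j) *m B.
      have vE e : v 0 e = B i e + B j e by rewrite /v mulmxDl -!rowE !mxE.
      have vB : (v <= kermx U *m B)%MS.
        apply/sub_kermx_mulP; exists (delta_mx 0 i + delta_mx 0 j) => //.
        rewrite mulmxDl -!rowE Ui Uj; apply/rowP => k; rewrite !mxE.
        exact: F2_addxx.
      have v0 : v != 0.
        apply: contraNneq EE => v0; apply/eqP/setP => e; rewrite !inE.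
        have := vE e; rewrite v0 mxE => /esym/eqP.
        rewrite addr_eq0 => /eqP ->; by rewrite oppr_eq0.
      apply: leq_trans (gmin v (submx_trans vB sV) v0) _.
      apply: leq_trans (leq_card_setU (E i) (E j)).
      apply/subset_leq_card/subsetP => e; rewrite !inE => ve.
      have eN : e \in N by apply: contraR ve => eN; rewrite (zB0 v e).
      move: ve; rewrite vE F2_add_neq0 eN.
      by case: (B i e != 0).
    have Mi : M = (#|L a :\ i|).+1 by rewrite /M (cardsD1 i) iL.
    have SdE : (Sd - d i = \sum_(j in L a :\ i) d j)%N.
      by rewrite /Sd (big_setD1 i) //= addKn.
    rewrite SdE Mi subn1 /= -sum_nat_const -big_split /=.
    rewrite (big_setID Z) /=.
    apply: leq_trans (leq_addl _ _).
    apply: (@leq_trans (\sum_(j in (L a :\ i) :\: Z) g)%N).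
      rewrite sum_nat_const mulnC leq_mul2r; apply/orP; right.
      have := cardsID Z (L a :\ i).
      have : (#|(L a :\ i) :&: Z| <= #|Z|)%N by apply/subset_leq_card/subsetIr.
      move: Z1; move: #|Z| #|_ :&: Z| #|_ :\: Z| #|_ :\ i| => *; lia.
    by apply: leq_sum => j; rewrite in_setD => /andP [jZ jL]; apply: good.
  have dS i : i \in L a -> (d i <= Sd)%N.
    by move=> iL; rewrite /Sd (bigD1 i) //= leq_addr.
  have [M2|M2] := leqP M 2; first by rewrite (eqP M2) muln0.
  have : (\sum_(i in L a) g * (M - 2) <= \sum_(i in L a) ((M - 2) * d i + Sd))%N.
    apply: leq_sum => i iL; have := pair i iL; have := dS i iL.
    by rewrite (_ : M - 1 = (M - 2).+1)%N ?mulSn; lia.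
  rewrite sum_nat_const big_split /= sum_nat_const -big_distrr /= -/M -/Sd.
  move=> H.
  have : (M * (g * (M - 2)) <= M * (2 * Sd))%N by nia.
  by rewrite leq_mul2l; case/orP => // /eqP; lia.
have I1E : (#|I1| = \sum_(a : 'rV['F_2]_t) #|L a|)%N.
  rewrite -sum1_card (partition_big (fun i => row i U) xpredT) //=.
  by apply: eq_bigr => a _; rewrite -sum1_card; apply: eq_bigl => i; rewrite !inE.
have dE : (\sum_(i in I1) d i = \sum_(a : 'rV['F_2]_t) \sum_(i in L a) d i)%N.
  rewrite (partition_big (fun i => row i U) xpredT) //=.
  by apply: eq_bigr => a _; apply: eq_bigl => i; rewrite !inE.
(* Over the 2^t labels, the loss of 2 vertices per class adds up to the term 2^(t+1). *)
have : (\sum_(a : 'rV['F_2]_t) g * #|L a| <= \sum_(a : 'rV['F_2]_t) (g * 2 + 2 * \sum_(i in L a) d i))%N.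
  by apply: leq_sum => a _; have := Lsum a; nia.
rewrite -big_distrr /= -I1E big_split /= sum_nat_const -big_distrr /= -dE.
rewrite card_mx card_Fp // mul1n => H.
have rI : (\rank V - t <= #|I1|)%N.
  by rewrite leq_subLR addnC (leq_trans rV) // leq_add2r.
have : (g * (\rank V - t) <= 2 ^ t.+1 * g + 4 * #|N|)%N.
  apply: leq_trans (_ : g * #|I1| <= _)%N; first by rewrite leq_mul2l rI orbT.
  by apply: leq_trans H _; rewrite expnS; nia.
by rewrite -NE (addnC _ t) subnDA mulnBl leq_subLR (mulnC (_ - _)%N).
Qed.

End PerturbedGraphic.

(** * Program logic for the random access machine *)

Section HaltProb.
Variables (R : realType) (W : nat).
Local Notation hp := (@halt_prob R W).

Lemma halt_prob_ge0 T s Q : (0 <= hp T s Q)%R.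
Proof.
elim: T s => [|T IH] s /=; case: ifP => _; rewrite ?ler0n //.
by rewrite divr_ge0 ?ler0n // sumr_ge0.
Qed.

Lemma halt_prob_le1 T s Q : (hp T s Q <= 1)%R.
Proof.
elim: T s => [|T IH] s /=; case: ifP => _; rewrite ?lern1 ?leq_b1 ?ler01 //.
have [->|nz] := eqVneq (size (step W s)) 0; first by rewrite invr0 mulr0 ler01.
rewrite ler_pdivrMr ?ltr0n ?lt0n // mul1r.
apply: le_trans (ler_sum _ (fun s' _ => IH s')) _.
by rewrite big_const_seq count_predT iter_addr_0.
Qed.

Lemma halt_prob_le T T' s Q : T <= T' -> (hp T s Q <= hp T' s Q)%R.
Proof.
move=> le; have {le} -> : T' = (T' - T) + T by lia.
elim: {T'}(T' - T) => // d IH; apply: le_trans IH _.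
rewrite addSn; move: (d + T) => {d}T; elim: T s => [|T IH] s /=; case: ifP => // nz.
  by rewrite divr_ge0 ?ler0n // sumr_ge0 // => s' _; apply: (halt_prob_ge0 0).
by apply: ler_wpM2r; rewrite ?invr_ge0 ?ler0n //; apply: ler_sum => s' _; apply: IH.
Qed.

Lemma halt_probE T c k m Q :
  hp T.+1 (c :: k, m) Q =
  (\sum_(s' <- step W (c :: k, m)) hp T s' Q / (size (step W (c :: k, m)))%:R)%R.
Proof. by rewrite -mulr_suml. Qed.

Lemma halt_prob_step T c k m s' Q :
  step W (c :: k, m) = [:: s'] -> hp T.+1 (c :: k, m) Q = hp T s' Q.
Proof. by move=> E; rewrite halt_probE E big_seq1 divr1. Qed.

Lemma halt_prob_if T e c1 c2 k m Q :
  hp T.+1 (If e c1 c2 :: k, m) Q = hp T ((if eval m e != 0 then c1 else c2) :: k, m) Q.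
Proof. exact: halt_prob_step. Qed.

Lemma halt_prob_while T e c k m Q :
  hp T.+1 (While e c :: k, m) Q =
  hp T (if eval m e != 0 then c :: While e c :: k else k, m) Q.
Proof. exact: halt_prob_step. Qed.

Variables (St : Type) (mem : St -> memory).

(* From [s], the command [c] surely terminates in [s'] within [t] steps. *)
Definition det c s t s' := forall k T Q,
  (hp T (k, mem s') Q <= hp (t + T) (c :: k, mem s) Q)%R.

(* From [s], the command [c] surely terminates within [t] steps, in a state
   satisfying [P], and the expectation of [F] in that state is at least [v]. *)
Definition wpe c s t (P : St -> Prop) (F : St -> R) v := forall k T Q,
  (forall s', P s' -> F s' <= hp T (k, mem s') Q)%R ->
  (v <= hp (t + T) (c :: k, mem s) Q)%R.

Lemma det_le c s t t' s' : det c s t s' -> t <= t' -> det c s t' s'.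
Proof.
move=> H le k T Q; apply: le_trans (H k T Q) _.
by apply: halt_prob_le; rewrite leq_add2r.
Qed.

Lemma det_skip s : det Skip s 1 s.
Proof. by move=> k T Q; rewrite add1n (@halt_prob_step _ _ _ _ (k, mem s)). Qed.

Lemma det_store a e s s' x y :
  eval (mem s) a = x -> eval (mem s) e = y -> x < W -> y < W ->
  update (mem s) x y = mem s' -> det (Store a e) s 1 s'.
Proof.
move=> ax ey xW yW E k T Q.
by rewrite add1n (@halt_prob_step _ _ _ _ (k, mem s')) //= ax ey xW yW E.
Qed.

Lemma det_seq c1 c2 s s1 s2 t1 t2 :
  det c1 s t1 s1 -> det c2 s1 t2 s2 -> det (Seq c1 c2) s (t1 + t2).+1 s2.
Proof.
move=> H1 H2 k T Q; rewrite addSn (@halt_prob_step _ _ _ _ (c1 :: c2 :: k, mem s)) //.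
by rewrite -addnA; apply: le_trans (H2 _ _ _) (H1 _ _ _).
Qed.

Lemma det_if e c1 c2 s s' t :
  det (if eval (mem s) e != 0 then c1 else c2) s t s' -> det (If e c1 c2) s t.+1 s'.
Proof. by move=> H k T Q; rewrite addSn halt_prob_if. Qed.

Lemma det_loop (I : nat -> St -> Prop) e c N t s :
  (forall i s, i < N -> I i s ->
     eval (mem s) e != 0 /\ exists2 s', I i.+1 s' & det c s t s') ->
  (forall s, I N s -> eval (mem s) e = 0) -> I 0 s ->
  exists2 s', I N s' & det (While e c) s (N * t.+1).+1 s'.
Proof.
move=> Hc HN; suff H : forall d s, d <= N -> I (N - d) s ->
    exists2 s', I N s' & det (While e c) s (d * t.+1).+1 s'.
  by move=> I0; apply: H; rewrite ?subnn.
elim=> [|d IH] {}s dN Is.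
  rewrite subn0 in Is; exists s => // k T Q; rewrite addSn.
  by rewrite halt_prob_while (HN _ Is).
have [|e0 [s1 I1 D1]] := Hc (N - d.+1) s _ Is; first by lia.
have [||s2 I2 D2] := IH s1; first by lia.
  by rewrite (_ : N - d = (N - d.+1).+1); lia || exact: I1.
exists s2 => // k T Q; rewrite addSn halt_prob_while e0.
have -> : d.+1 * t.+1 + T = t + ((d * t.+1).+1 + T) by lia.
exact: le_trans (D2 _ _ _) (D1 _ _ _).
Qed.

Lemma wpe_conseq c s t t' P P' F F' v v' :
  wpe c s t P F v -> t <= t' -> (v' <= v)%R ->
  (forall s', P s' -> P' s' /\ (F s' <= F' s')%R) -> wpe c s t' P' F' v'.
Proof.
move=> H tt' vv' PP k T Q HQ; apply: le_trans vv' _.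
apply: le_trans (H k T Q _) _; last by apply: halt_prob_le; rewrite leq_add2r.
by move=> s' /PP [P's' FF]; apply: le_trans FF (HQ _ P's').
Qed.

Lemma wpe_det c s t s' (P : St -> Prop) F v :
  det c s t s' -> P s' -> (v <= F s')%R -> wpe c s t P F v.
Proof. by move=> H Ps vF k T Q HQ; apply: le_trans vF (le_trans (HQ _ Ps) (H _ _ _)). Qed.

(** The tower rule: the bound [F1] obtained for the second command is the function whose expectation
    the first command bounds. *)
Lemma wpe_seq c1 c2 s t1 t2 P1 F1 P F v :
  wpe c1 s t1 P1 F1 v -> (forall s1, P1 s1 -> wpe c2 s1 t2 P F (F1 s1)) ->
  wpe (Seq c1 c2) s (t1 + t2).+1 P F v.
Proof.
move=> H1 H2 k T Q HQ; rewrite addSn (@halt_prob_step _ _ _ _ (c1 :: c2 :: k, mem s)) //.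
by rewrite -addnA; apply: H1 => s1 /H2; apply.
Qed.

Lemma wpe_det_seq c1 c2 s s1 t1 t2 P F v :
  det c1 s t1 s1 -> wpe c2 s1 t2 P F v -> wpe (Seq c1 c2) s (t1 + t2).+1 P F v.
Proof.
move=> H1 H2; apply: (@wpe_seq _ _ _ _ _ (eq s1) (fun=> v)) => [|_ <- //].
exact: wpe_det H1 _ _.
Qed.

Lemma wpe_if e c1 c2 s t P F v :
  wpe (if eval (mem s) e != 0 then c1 else c2) s t P F v ->
  wpe (If e c1 c2) s t.+1 P F v.
Proof. by move=> H k T Q HQ; rewrite addSn halt_prob_if; apply: H. Qed.

Lemma wpe_while_end e c s (P : St -> Prop) F :
  eval (mem s) e = 0 -> P s -> wpe (While e c) s 1 P F (F s).
Proof.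
move=> e0 Ps k T Q HQ; rewrite addSn halt_prob_while e0.
exact: HQ.
Qed.

(** One round only: the bound changes from round to round, so the induction is left to each use. *)
Lemma wpe_while e c s t1 t2 P1 F1 P F v :
  eval (mem s) e != 0 -> wpe c s t1 P1 F1 v ->
  (forall s1, P1 s1 -> wpe (While e c) s1 t2 P F (F1 s1)) ->
  wpe (While e c) s (t1 + t2).+1 P F v.
Proof.
move=> e0 H1 H2 k T Q HQ; rewrite addSn halt_prob_while e0.
by rewrite -addnA; apply: H1 => s1 /H2; apply.
Qed.

Lemma wpe_draw a e s x N (s_ : nat -> St) (P : St -> Prop) F :
  eval (mem s) a = x -> eval (mem s) e = N -> x < W -> N < W ->
  (forall i, i <= N -> update (mem s) x i = mem (s_ i) /\ P (s_ i)) ->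
  wpe (Draw a e) s 1 P F ((\sum_(i <- iota 0 N.+1) F (s_ i)) / N.+1%:R)%R.
Proof.
move=> ax eN xW NW E k T Q HQ.
have stepE : step W (Draw a e :: k, mem s) =
    [seq (k, update (mem s) x i) | i <- iota 0 N.+1] by rewrite /= ax eN xW NW.
rewrite add1n halt_probE stepE size_map size_iota -mulr_suml.
apply: ler_wpM2r; rewrite ?invr_ge0 ?ler0n //.
rewrite big_map big_seq [X in (_ <= X)%R]big_seq; apply: ler_sum => i.
by rewrite mem_iota add0n ltnS => /E [-> Pi]; apply: HQ.
Qed.

End HaltProb.

(** * The elimination program *)

Definition bitmx := nat -> nat -> bool.

Section RowSpace.
Variable n : nat.
Implicit Types (f : bitmx).
Local Open Scope ring_scope.

Definition rowv f i : 'rV['F_2]_n := \row_(j < n) (f i j)%:R.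

(* The rows [k], ..., [m - 1] of [f]. *)
Definition rows f k m : 'M['F_2]_(m, n) :=
  \matrix_(i < m, j < n) (if (k <= i)%N then (f i j)%:R else 0).

Definition addrow f d s : bitmx :=
  fun i j => if (i == d) && (j < n)%N then f i j (+) f s j else f i j.

Lemma natrF2_neq0 (b : bool) : (b%:R != 0 :> 'F_2) = b.
Proof. by case: b. Qed.

Lemma rowv_sub f k m i : (k <= i < m)%N -> (rowv f i <= rows f k m)%MS.
Proof.
case/andP=> ki im; apply/(eq_row_sub (Ordinal im))/rowP => j.
by rewrite !mxE /= ki.
Qed.

Lemma rows_sub p f k m (X : 'M_(p, n)) :
  (forall i, (k <= i < m)%N -> (rowv f i <= X)%MS) -> (rows f k m <= X)%MS.
Proof.
move=> H; apply/row_subP => i; have [ki|ki] := leqP k i.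
  have -> : row i (rows f k m) = rowv f i by apply/rowP => j; rewrite !mxE ki.
  by apply: H; rewrite ki ltn_ord.
have -> : row i (rows f k m) = 0; last exact: sub0mx.
by apply/rowP => j; rewrite !mxE leqNgt ki.
Qed.

Lemma eq_rowv f g i : (forall j, (j < n)%N -> f i j = g i j) -> rowv f i = rowv g i.
Proof. by move=> E; apply/rowP => j; rewrite !mxE E. Qed.

Lemma rowv_addrow f d s i :
  rowv (addrow f d s) i = if i == d then rowv f d + rowv f s else rowv f i.
Proof.
case: eqP => [->|/eqP/negPf id]; apply/rowP => j; rewrite !mxE /addrow ?eqxx ?id //=.
by rewrite ltn_ord; case: (f d j); case: (f s j); apply/eqP.
Qed.

Lemma rows_addrow_sub f k m d s :
  (k <= d < m)%N -> (k <= s < m)%N -> (rows (addrow f d s) k m <= rows f k m)%MS.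
Proof.
move=> dm sm; apply: rows_sub => i im; rewrite rowv_addrow.
by case: eqP => _; [apply: addmx_sub|]; apply: rowv_sub.
Qed.

(** A row addition over GF(2) undoes itself, so the inclusion for one addition gives both
    directions. *)
Lemma rows_addrow f k m d s :
  (k <= d < m)%N -> (k <= s < m)%N -> d != s -> (rows (addrow f d s) k m :=: rows f k m)%MS.
Proof.
move=> dm sm ds; apply/eqmxP; rewrite rows_addrow_sub //=.
apply: rows_sub => i im.
have := rows_addrow_sub (addrow f d s) dm sm; apply: submx_trans.
have -> : rowv f i = rowv (addrow (addrow f d s) d s) i; last exact: rowv_sub.
rewrite !rowv_addrow eqxx (eq_sym s) (negPf ds); case: eqP => [->|//].
by apply/rowP => j; rewrite !mxE -addrA F2_addxx addr0.
Qed.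

Lemma rows_anti f k k' m : (k <= k')%N -> (rows f k' m <= rows f k m)%MS.
Proof. by move=> kk; apply: rows_sub => i im; apply: rowv_sub; lia. Qed.

Lemma rows_S f k m : (k < m)%N -> (rows f k m :=: rowv f k + rows f k.+1 m)%MS.
Proof.
move=> km; apply/eqmxP/andP; split.
  apply: rows_sub => i /andP [ki im]; move: ki; rewrite leq_eqVlt => /orP [/eqP <-|ki].
    exact: addsmxSl.
  by apply: submx_trans (addsmxSr _ _); apply: rowv_sub; rewrite ki.
by rewrite addsmx_sub rowv_sub ?leqnn //= rows_anti.
Qed.

Lemma eqmx_rows_S f g k m : (k < m)%N -> rowv f k = rowv g k ->
  (rows f k.+1 m :=: rows g k.+1 m)%MS -> (rows f k m :=: rows g k m)%MS.
Proof.
move=> km E H; apply: eqmx_trans (rows_S f km) _.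
apply: eqmx_trans _ (eqmx_sym (rows_S g km)); rewrite E; exact: adds_eqmx.
Qed.

Lemma nzcols_rows f k m (j : 'I_n) :
  (j \in nzcols (rows f k m)) = [exists i : 'I_m, (k <= i)%N && f i j].
Proof.
by apply/nzcolsP/existsP => -[i H]; exists i; move: H; rewrite mxE; case: ifP => // _;
  rewrite natrF2_neq0.
Qed.

(** Among these rows only row [k] is nonzero in column [j], so a combination that vanishes there
    does not involve it. *)
Lemma rows_pivot f k m (j : 'I_n) : (k < m)%N -> f k j ->
  (forall i, (k < i < m)%N -> ~~ f i j) ->
  (rows f k.+1 m :=: contr (rows f k m) j)%MS.
Proof.
move=> km fk fi; apply/eqmxP/andP; split.
  apply: rows_sub => i im; rewrite sub_contr rowv_sub /=; last lia.
  by rewrite mxE (negPf (fi _ im)).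
apply/rV_subP => v; rewrite sub_contr (rows_S f km) => /andP [].
case/sub_addsmxP => -[a b] /= -> /eqP.
have [c ->] : exists c, a = c%:M by exists (a 0 0); rewrite -mx11_scalar.
have /submxP [D DE] := submxMl b (rows f k.+1 m).
have b0 : (b *m rows f k.+1 m) 0 j = 0.
  rewrite mxE big1 // => i _; rewrite !mxE; case: ifP => [ki|_]; rewrite ?mulr0 //.
  by rewrite (negPf (fi _ _)) ?mulr0 // ki ltn_ord.
rewrite mxE b0 addr0 mul_scalar_mx !mxE fk mulr1 => ->.
by rewrite scale0r add0r submxMl.
Qed.

End RowSpace.

(* Register [q] is the cell [q] after the input. The registers hold:
   0, 1 the row bounds [k], [m] of the current elimination; 2, 3, 4 the loop
   indices; 5 the number of nonzero columns; 6 that number at the last pivot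
   (when the elimination stops, the weight of the last row); 7 the least weight
   found so far, 0 for none; 8 the integer square root of [r]; 9, 10 the
   remaining outer and inner runs; 11 the column sum, then the drawn index.
   The list of the nonzero columns comes after them. *)
Definition rE := Read (Const 0).
Definition nE := Read (Const 1).
Definition baseE := Bin Add (Const 2) (Bin Mul (Const 2) (Bin Mul rE nE)).
Definition reg q := Bin Add baseE (Const q).
Definition rg q := Read (reg q).
Definition entA i j := Bin Add (Const 2) (Bin Add (Bin Mul i nE) j).
Definition ent i j := Read (entA i j).
Definition lstA e := Bin Add baseE (Bin Add (Const 12) e).
(** On bits, inequality is addition modulo 2. *)
Definition xorE a b := Bin Eq (Bin Eq a b) (Const 0).
Definition incr q := Store (reg q) (Bin Add (rg q) (Const 1)).

Definition add_row d s :=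
  Seq (Store (reg 4) (Const 0))
  (While (Bin Lt (rg 4) nE)
    (Seq (Store (entA d (rg 4)) (xorE (ent d (rg 4)) (ent s (rg 4))))
         (incr 4))).

Definition col_sum :=
  Seq (Store (reg 11) (Const 0))
  (Seq (Store (reg 2) (rg 0))
  (While (Bin Lt (rg 2) (rg 1))
    (Seq (Store (reg 11) (Bin Add (rg 11) (ent (rg 2) (rg 3))))
         (incr 2)))).

Definition list_cols :=
  Seq (Store (reg 5) (Const 0))
  (Seq (Store (reg 3) (Const 0))
  (While (Bin Lt (rg 3) nE)
    (Seq col_sum
    (Seq (If (rg 11) (Seq (Store (lstA (rg 5)) (rg 3)) (incr 5)) Skip)
         (incr 3))))).

(* If the pivot row [k] lacks a 1 in the column, it first receives one from the
   current row, so that rows are never swapped. *)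
Definition clear_col :=
  Seq (Store (reg 2) (Bin Add (rg 0) (Const 1)))
  (While (Bin Lt (rg 2) (rg 1))
    (Seq
      (If (ent (rg 2) (rg 3))
        (Seq (If (ent (rg 0) (rg 3)) Skip (add_row (rg 0) (rg 2)))
             (add_row (rg 2) (rg 0)))
        Skip)
      (incr 2))).

(** [Draw] includes its upper bound, hence the count minus 1. *)
Definition pivot_body :=
  Seq (Store (reg 6) (rg 5))
  (Seq (Draw (reg 11) (Bin Defs.Sub (rg 5) (Const 1)))
  (Seq (Store (reg 3) (Read (lstA (rg 11))))
  (Seq clear_col
       (incr 0)))).

Definition pivot_step := Seq list_cols (If (rg 5) pivot_body Skip).

(** The 1 in register 5 only serves to enter the loop, whose body recomputes that register. *)
Definition eliminate :=
  Seq (Store (reg 6) (Const 0))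
  (Seq (Store (reg 5) (Const 1))
       (While (rg 5) pivot_step)).

Definition update_best :=
  If (Bin Add (Bin Eq (rg 7) (Const 0)) (Bin Lt (rg 6) (rg 7)))
    (Store (reg 7) (rg 6)) Skip.

(** Only the last rows, as many as the square root of [r], are eliminated afresh; truncated
    subtraction takes all the rows when there are fewer. The rows above stay in place, so the whole
    row space survives for the next outer run. *)
Definition inner_step :=
  Seq (Store (reg 0) (Bin Defs.Sub (rg 1) (rg 8)))
  (Seq eliminate
  (Seq update_best
       (Store (reg 10) (Bin Defs.Sub (rg 10) (Const 1))))).

(** The elimination stops at a row index equal to the rank, below which all rows vanish; this index
    becomes the new row bound. *)
Definition outer_step K :=
  Seq (Store (reg 0) (Const 0))
  (Seq eliminate
  (Seq (Store (reg 1) (rg 0))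
  (Seq (Store (reg 10) (Bin Mul (Const K) (Bin Mul rE rE)))
  (Seq (While (rg 10) inner_step)
       (Store (reg 9) (Bin Defs.Sub (rg 9) (Const 1))))))).

Definition sum_rows :=
  While (Bin Lt (rg 2) rE)
    (Seq (add_row (rg 2) (Bin Add rE (rg 2))) (incr 2)).

Definition isqrt :=
  While (Bin Lt (Bin Mul (Bin Add (rg 8) (Const 1)) (Bin Add (rg 8) (Const 1)))
                (Bin Add rE (Const 1)))
    (incr 8).

(* The rows of [A] are followed in memory by those of [P], so [A + P] is computed
   by row additions in a matrix of [2 * r] rows; see [sum_rows]. *)
Definition init K :=
  Seq sum_rows
  (Seq isqrt
  (Seq (Store (reg 1) rE)
       (Store (reg 9) (Bin Mul (Const K) (Bin Mul rE rE))))).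

(** The test on [n] is for the running time: the time allowed at n = 0 is a constant, so not even a
    loop over [r] is affordable there. *)
Definition cogirth_prog K1 K2 :=
  Seq (If nE (Seq (init K1) (While (rg 9) (outer_step K2))) Skip)
      (Store (Const 0) (rg 7)).

(** * The memory as a bit matrix, registers and a list *)

Section Machine.
Variables (R : realType) (W r n : nat).

(* The matrix with the rows of the two input matrices, the twelve registers and
   the list of columns. *)
Definition mstate := (bitmx * seq nat * (nat -> nat))%type.

Definition base := 2 + 2 * (r * n).

Definition memory_of (s : mstate) : memory := fun b =>
  let: (f, xs, L) := s in
  if b < base then
    if b is b'.+2 then nat_of_bool (f (b' %/ n) (b' %% n)) else if b == 0 then r else n
  else if b - base < 12 then nth 0 xs (b - base) else L (b - base - 12).

Lemma evalB m o a b : eval m (Bin o a b) = eval_binop o (eval m a) (eval m b).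
Proof. by []. Qed.

Lemma evalC m k : eval m (Const k) = k. Proof. by []. Qed.

Arguments eval : simpl never.

Lemma eval_rE s : eval (memory_of s) rE = r.
Proof. by case: s => [[f xs] L]. Qed.

Lemma eval_nE s : eval (memory_of s) nE = n.
Proof. by case: s => [[f xs] L]. Qed.

Lemma eval_baseE s : eval (memory_of s) baseE = base.
Proof. by rewrite /baseE !evalB eval_rE eval_nE. Qed.

Lemma eval_rg f xs L q : q < 12 -> eval (memory_of (f, xs, L)) (rg q) = nth 0 xs q.
Proof.
move=> q12; rewrite /rg -[LHS]/(memory_of _ (eval (memory_of (f, xs, L)) (reg q))).
by rewrite /reg evalB eval_baseE /= ltnNge leq_addr /= addKn q12.
Qed.

Lemma ent_lt i j : i < 2 * r -> j < n -> 2 + (i * n + j) < base.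
Proof. by rewrite /base; nia. Qed.

Lemma eval_ent f xs L a b i j : i < 2 * r -> j < n ->
  eval (memory_of (f, xs, L)) a = i -> eval (memory_of (f, xs, L)) b = j ->
  eval (memory_of (f, xs, L)) (ent a b) = f i j.
Proof.
move=> ir jn ai bj; rewrite -[LHS]/(memory_of _ (eval (memory_of (f, xs, L)) (entA a b))).
rewrite !evalB eval_nE ai bj /=; have /= := ent_lt ir jn; rewrite add2n => ->.
by rewrite divnMDl ?modnMDl ?(modn_small jn) ?(divn_small jn) ?addn0 //; lia.
Qed.

Lemma eval_lst f xs L a q : eval (memory_of (f, xs, L)) a = q ->
  eval (memory_of (f, xs, L)) (Read (lstA a)) = L q.
Proof.
move=> aq; rewrite -[LHS]/(memory_of _ (eval (memory_of (f, xs, L)) (lstA a))).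
rewrite evalB eval_baseE !evalB aq /= ltnNge leq_addr /= addKn ltnNge leq_addr /=.
by rewrite addKn.
Qed.

Hypothesis W_large : base + 12 + n + r + 2 < W.

Local Notation det := (@det R W _ memory_of).

Lemma update_reg f xs L q v : q < 12 -> size xs = 12 ->
  update (memory_of (f, xs, L)) (base + q) v = memory_of (f, set_nth 0 xs q v, L).
Proof.
move=> q12 xs12; apply/funext => b; rewrite /update /memory_of; case: eqP => [->|bq].
  by rewrite ltnNge leq_addr /= addKn q12 nth_set_nth /= eqxx.
case: ifP => // /negbT; rewrite -leqNgt => bb; case: ifP => // b12.
by rewrite nth_set_nth /=; case: eqP => //; lia.
Qed.

Lemma det_set q e v f xs L : q < 12 -> size xs = 12 ->
  eval (memory_of (f, xs, L)) e = v -> v < W ->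
  det (Store (reg q) e) (f, xs, L) 1 (f, set_nth 0 xs q v, L).
Proof.
move=> q12 xs12 ev vW; apply: (@det_store _ _ _ _ _ _ _ _ (base + q) v) => //.
  lia.
exact: update_reg.
Qed.

Lemma det_incr q f xs L : q < 12 -> size xs = 12 -> nth 0 xs q + 1 < W ->
  det (incr q) (f, xs, L) 1 (f, set_nth 0 xs q (nth 0 xs q + 1), L).
Proof. by move=> q12 xs12 lt; apply: det_set => //; rewrite evalB eval_rg. Qed.

Lemma det_set_lst a e q v f xs L :
  eval (memory_of (f, xs, L)) a = q -> eval (memory_of (f, xs, L)) e = v -> q <= n -> v < W ->
  det (Store (lstA a) e) (f, xs, L) 1 (f, xs, update L q v).
Proof.
move=> aq ev qn vW; apply: (@det_store _ _ _ _ _ _ _ _ (base + (12 + q)) v) => //.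
- by rewrite /lstA evalB eval_baseE !evalB aq.
- lia.
apply/funext => b; rewrite /update /memory_of; case: eqP => [->|bq].
  by rewrite ltnNge leq_addr /= addKn ltnNge leq_addr /= addKn eqxx.
case: ifP => // /negbT; rewrite -leqNgt => bb; case: ifP => // /negbT b12.
by case: eqP => //; lia.
Qed.

Lemma det_set_ent a b e i j (v : bool) f xs L : i < 2 * r -> j < n ->
  eval (memory_of (f, xs, L)) a = i -> eval (memory_of (f, xs, L)) b = j ->
  eval (memory_of (f, xs, L)) e = v ->
  det (Store (entA a b) e) (f, xs, L) 1
    (fun i' j' => if (i' == i) && (j' == j) then v else f i' j', xs, L).
Proof.
move=> ir jn ai bj ev; have lt := ent_lt ir jn.
apply: (@det_store _ _ _ _ _ _ _ _ (2 + (i * n + j)) v) => //.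
- by rewrite !evalB eval_nE ai bj.
- lia.
- by case: v {ev}; lia.
apply/funext => c; rewrite /update /memory_of; case: eqP => [->|cij].
  rewrite lt add2n divnMDl ?modnMDl ?(modn_small jn) ?(divn_small jn) ?addn0 ?eqxx //.
  lia.
case: ifP => // _; case: c cij => [|[|c]] // cij; case: ifP => // /andP [/eqP ci /eqP cj].
by case: cij; rewrite add2n -ci -cj -divn_eq.
Qed.

(** The addresses [a] and [b] are evaluated anew in every round, while the matrix and register 4
    change; hence the quantified hypotheses on them. *)
Lemma det_add_row a b d s f xs L : size xs = 12 -> d < 2 * r -> s < 2 * r -> d != s ->
  (forall f' x, eval (memory_of (f', set_nth 0 xs 4 x, L)) a = d) ->
  (forall f' x, eval (memory_of (f', set_nth 0 xs 4 x, L)) b = s) ->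
  det (add_row a b) (f, xs, L) (n * 4 + 3) (addrow n f d s, set_nth 0 xs 4 n, L).
Proof.
move=> xs12 dr sr ds da sb.
(* The matrix after the first [i] entries of row [d] have been replaced. *)
pose f_ i : bitmx := fun x y => if (x == d) && (y < i) then f x y (+) f s y else f x y.
pose I i st := st = (f_ i, set_nth 0 xs 4 i, L).
have x4 x : nth 0 (set_nth 0 xs 4 x) 4 = x by rewrite nth_set_nth.
have sz x : size (set_nth 0 xs 4 x) = 12 by rewrite size_set_nth xs12.
have set4 x y : set_nth 0 (set_nth 0 xs 4 x) 4 y = set_nth 0 xs 4 y.
  by rewrite set_set_nth.
have [|st|//|_ -> D2] := @det_loop R W _ memory_of I (Bin Lt (rg 4) nE)
  (Seq (Store (entA a (rg 4)) (xorE (ent a (rg 4)) (ent b (rg 4)))) (incr 4))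
  n 3 (f, set_nth 0 xs 4 0, L).
- move=> i st lt ->; rewrite evalB eval_nE eval_rg // x4 /= lt; split=> //.
  exists (f_ i.+1, set_nth 0 xs 4 i.+1, L) => //.
  apply: (det_seq (t1 := 1) (t2 := 1)).
    apply: (@det_set_ent _ _ _ d i (f d i (+) f s i)) => //.
      by rewrite eval_rg.
    rewrite !evalB evalC.
    rewrite (@eval_ent _ _ _ _ _ d i) ?eval_rg //.
    rewrite (@eval_ent _ _ _ _ _ s i) ?eval_rg // /f_ /=.
    by rewrite ltnn !andbF; case: (f d i); case: (f s i).
  have := @det_incr 4 (fun i' j' => if (i' == d) && (j' == i) then f d i (+) f s i else f_ i i' j')
    (set_nth 0 xs 4 i) L; rewrite x4 set4 addn1.
  rewrite (_ : (fun i' j' => _) = f_ i.+1); first by apply; rewrite ?sz //; lia.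
  apply/funext => x; apply/funext => y; rewrite /f_ ltnS [y <= i]leq_eqVlt.
  by case: (eqVneq x d) => //= ->; case: (eqVneq y i) => //= ->.
- by move=> ->; rewrite evalB eval_nE eval_rg // x4 /= ltnn.
- by rewrite /I; congr (_, _, _); apply/funext => x; apply/funext => y; rewrite /f_ ltn0 andbF.
apply: det_le (det_seq (s1 := (f, set_nth 0 xs 4 0, L)) (t1 := 1) _ D2) _; last lia.
by apply: det_set => //; lia.
Qed.

End Machine.

Arguments eval : simpl never.

(** * Listing the nonzero columns and clearing one of them *)

Definition cols n (f : bitmx) k m :=
  [seq j <- iota 0 n | has (fun i => f i j) (iota k (m - k))].

Lemma cols_lt n f k m j : j \in cols n f k m -> j < n.
Proof. by rewrite mem_filter mem_iota => /andP [_ /andP []]. Qed.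

Lemma size_cols n f k m : size (cols n f k m) <= n.
Proof. by rewrite size_filter (leq_trans (count_size _ _)) // size_iota. Qed.

Lemma cols_nzcols n f k m : [seq val j | j <- enum (nzcols (rows n f k m))] = cols n f k m.
Proof.
rewrite /cols -val_enum_ord filter_map; congr map.
rewrite enumT [LHS]/(filter _ _); apply: eq_filter => j /=.
rewrite -[LHS]/(j \in nzcols (rows n f k m)) nzcols_rows.
apply/existsP/hasP => [[i /andP [ki fij]]|[i]].
  by exists (val i) => //; rewrite mem_iota ki /=; have := ltn_ord i; lia.
rewrite mem_iota => /andP [ki im] fij; have im' : i < m by lia.
by exists (Ordinal im') => /=; rewrite ki.
Qed.

Lemma size_cols_nzcols n f k m : size (cols n f k m) = #|nzcols (rows n f k m)|.
Proof. by rewrite -cols_nzcols size_map -cardE. Qed.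

Section Elimination.
Variables (R : realType) (W r n : nat).
Hypothesis W_large : base r n + 12 + n + r + 2 < W.

Local Notation mem := (memory_of r n).
Local Notation det := (@det R W _ mem).
Local Notation wpe := (@wpe R W _ mem).
Local Notation rows := (rows n).

Local Notation set_reg := (@det_set R W r n W_large).

(** The sum is taken over the natural numbers, so it is nonzero exactly when the column is. *)
Lemma det_col_sum f k m i j l c w b s a d u L : k <= m <= r -> j < n ->
  det col_sum (f, [:: k; m; i; j; l; c; w; b; s; a; d; u], L) ((m - k) * 4 + 5)
    (f, [:: k; m; m; j; l; c; w; b; s; a; d; count (fun i => f i j) (iota k (m - k))], L).
Proof.
move=> km jn.
pose I q st := st = (f, [:: k; m; k + q; j; l; c; w; b; s; a; d;
  count (fun i => f i j) (iota k q)], L).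
have [q st lt ->|st ->||_ -> D] := @det_loop R W _ mem I (Bin Lt (rg 2) (rg 1))
  (Seq (Store (reg 11) (Bin Add (rg 11) (ent (rg 2) (rg 3)))) (incr 2)) (m - k) 3
  (f, [:: k; m; k; j; l; c; w; b; s; a; d; 0], L).
- rewrite evalB !eval_rg //=; split; first by rewrite (_ : k + q < m) //; lia.
  exists (f, [:: k; m; k + q + 1; j; l; c; w; b; s; a; d;
    count (fun i => f i j) (iota k q) + f (k + q) j], L).
    rewrite /I -(addn1 q) iotaD count_cat /= addn0.
    by rewrite addnA.
  apply: (det_seq (t1 := 1) (t2 := 1)).
    apply: (set_reg (q := 11) (v := count (fun i => f i j) (iota k q) + f (k + q) j)) => //.
      by rewrite evalB (@eval_ent _ _ _ _ _ _ _ (k + q) j) ?eval_rg //; lia.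
    have := count_size (fun i => f i j) (iota k q); rewrite size_iota.
    by case: (f _ _); lia.
  by apply: det_incr => //=; lia.
- by rewrite evalB !eval_rg //= subnKC ?ltnn //; case/andP: km.
- by rewrite /I addn0.
rewrite subnKC in D; last by case/andP: km.
apply: det_le (det_seq (t1 := 1) _ (det_seq (t1 := 1) _ D)) _; last lia.
  by apply: (set_reg (q := 11) (v := 0)) => //; lia.
by apply: (set_reg (q := 2) (v := k)) => //; [rewrite eval_rg|lia].
Qed.

Lemma det_list_cols f k m i j l c w b s a d u L : k <= m <= r ->
  exists i' u' L',
    det list_cols (f, [:: k; m; i; j; l; c; w; b; s; a; d; u], L)
      (n * ((m - k) * 4 + 13) + 5)
      (f, [:: k; m; i'; n; l; size (cols n f k m); w; b; s; a; d; u'], L') /\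
    forall q, q < size (cols n f k m) -> L' q = nth 0 (cols n f k m) q.
Proof.
move=> km.
pose cs q := [seq j <- iota 0 q | has (fun i => f i j) (iota k (m - k))].
pose I q st := exists i' u' L',
  st = (f, [:: k; m; i'; q; l; size (cs q); w; b; s; a; d; u'], L') /\
  forall p, p < size (cs q) -> L' p = nth 0 (cs q) p.
have csz q : size (cs q) <= q.
  by rewrite size_filter (leq_trans (count_size _ _)) // size_iota.
have csS q : cs q.+1 = if has (fun i => f i q) (iota k (m - k)) then rcons (cs q) q else cs q.
  rewrite /cs -addn1 iotaD filter_cat /= add0n; case: ifP => _.
    by rewrite cats1.
  by rewrite cats0.
have [q st lt [i' [u' [L' [-> HL]]]]|st [i' [u' [L' [-> HL]]]]||st [i' [u' [L' [-> HL]]]] D] :=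
  @det_loop R W _ mem I (Bin Lt (rg 3) nE)
  (Seq col_sum
    (Seq (If (rg 11) (Seq (Store (lstA (rg 5)) (rg 3)) (incr 5)) Skip)
         (incr 3))) n ((m - k) * 4 + 12) 
  (f, [:: k; m; i; 0; l; 0; w; b; s; a; d; u], L).
- rewrite evalB eval_nE eval_rg //= lt; split => //.
  have cq := csz q.
  set u1 := count (fun i => f i q) (iota k (m - k)).
  have uE : has (fun i => f i q) (iota k (m - k)) = (u1 != 0) by rewrite has_count lt0n.
  pose L1 := if u1 != 0 then update L' (size (cs q)) q else L'.
  exists (f, [:: k; m; m; q + 1; l; size (cs q.+1); w; b; s; a; d; u1], L1).
    exists m, u1, L1; split; first by rewrite addn1.
    move=> p; rewrite csS uE /L1; case: ifP => _; last exact: HL.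
    rewrite size_rcons nth_rcons /update ltnS; case: eqP => [->|pq ple].
      by rewrite ltnn.
    by rewrite ifT ?HL //; lia.
  apply: det_le (det_seq (det_col_sum f i' l (size (cs q)) w b s a d u' L' km lt)
    (det_seq (t1 := 4) (t2 := 1)
       (s1 := (f, [:: k; m; m; q; l; size (cs q.+1); w; b; s; a; d; u1], L1)) _ _)) _; last lia.
    apply: det_if; rewrite eval_rg //= -/u1 csS uE /L1; case: ifP => [u10|u10].
      rewrite size_rcons -[(size (cs q)).+1]addn1.
      apply: (det_seq (t1 := 1) (t2 := 1)).
        apply: (@det_set_lst _ _ _ _ W_large _ _ (size (cs q)) q); rewrite ?eval_rg //; lia.
      by apply: det_incr => //=; lia.
    by apply: det_le (det_skip _ _ _ _) _.
  by apply: det_incr => //=; lia.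
- by rewrite evalB eval_nE eval_rg //= ltnn.
- by exists i, u, L.
exists i', u', L'; split => //.
apply: det_le (det_seq (t1 := 1) _ (det_seq (t1 := 1) _ D)) _; last lia.
  by apply: (set_reg (q := 5) (v := 0)) => //; lia.
by apply: (set_reg (q := 3) (v := 0)) => //; lia.
Qed.

Lemma addrowE (f : bitmx) d s y : y != d -> addrow n f d s y = f y.
Proof. by move=> yd; apply/funext => j; rewrite /addrow (negPf yd). Qed.

Lemma addrow_eq (f : bitmx) d s j : j < n -> addrow n f d s d j = f d j (+) f s j.
Proof. by move=> jn; rewrite /addrow eqxx jn. Qed.

Lemma det_clear_col (f : bitmx) k m i j l c w b s a d u L :
  k < m <= r -> j < n -> (exists2 y, k <= y < m & f y j) ->
  exists f' l', [/\
    det clear_col (f, [:: k; m; i; j; l; c; w; b; s; a; d; u], L)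
      ((m - k) * (8 * n + 12) + 3)
      (f', [:: k; m; m; j; l'; c; w; b; s; a; d; u], L),
    (forall y, y < k -> f' y = f y),
    (rows f' k m :=: rows f k m)%MS, f' k j &
    (forall y, k < y < m -> ~~ f' y j)].
Proof.
move=> km jn exy.
(* The last clause refers to the original [f]: the pivot row has its 1 as soon as some row seen so
   far, [k] included, had one. With [exy] this gives [f' k j] at the end. *)
pose I q (st : mstate) := exists f' l',
  st = (f', [:: k; m; k + 1 + q; j; l'; c; w; b; s; a; d; u], L) /\
  [/\ (forall y, y < k \/ k + 1 + q <= y -> f' y = f y),
    (rows f' k m :=: rows f k m)%MS,
    (forall y, k < y < k + 1 + q -> ~~ f' y j) &
    (forall y, k <= y < k + 1 + q -> f y j -> f' k j)].
have [q st lt [f' [l' [-> [H1 H2 H3 H4]]]]|st [f' [l' [-> _]]]||st [f' [l' [-> [H1 H2 H3 H4]]]] D] :=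
  @det_loop R W _ mem I (Bin Lt (rg 2) (rg 1))
  (Seq
      (If (ent (rg 2) (rg 3))
        (Seq (If (ent (rg 0) (rg 3)) Skip (add_row (rg 0) (rg 2)))
             (add_row (rg 2) (rg 0)))
        Skip)
      (incr 2)) (m - k - 1) (8 * n + 11)
  (f, [:: k; m; k + 1; j; l; c; w; b; s; a; d; u], L).
- rewrite evalB !eval_rg //=; set y0 := k + 1 + q; have y0m : y0 < m by rewrite /y0; lia.
  rewrite y0m; split=> //.
  have E1 : y0 + 1 = k + 1 + q.+1 by rewrite /y0; lia.
  have y0k : y0 != k by rewrite /y0; lia.
  have f'y0 : f' y0 = f y0 by apply: H1; right.
  have [f''f|f''t] := boolP (f' y0 j); last first.
    exists (f', [:: k; m; y0 + 1; j; l'; c; w; b; s; a; d; u], L).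
      exists f', l'; split; first by rewrite E1.
      split=> // [y [yk|yy]|y yy|y yy fy]; [by apply: H1; left|apply: H1; right; lia| |].
        by have [->//|ne] := eqVneq y y0; apply: H3; rewrite /y0 in ne *; lia.
      have [yE|ne] := eqVneq y y0; first by rewrite yE -f'y0 (negPf f''t) in fy.
      by apply: (H4 y) => //; rewrite /y0 in ne *; lia.
    apply: det_le (det_seq (t1 := 2) (t2 := 1)
      (s1 := (f', [:: k; m; y0; j; l'; c; w; b; s; a; d; u], L)) _ _) _; [| |lia].
      apply: det_if; rewrite (@eval_ent _ _ _ _ _ _ _ y0 j) ?eval_rg //; last lia.
      by rewrite (negPf f''t); exact: det_skip.
    by apply: det_incr => //=; lia.
  (* The matrix once the pivot row has a 1 in column [j], borrowed from row [y0] if necessary. *)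
  pose f1 := if f' k j then f' else addrow n f' k y0.
  have f1k : f1 k j.
    by rewrite /f1; case: ifP => // fk; rewrite addrow_eq // fk f''f.
  have f1y y : y != k -> f1 y = f' y.
    by move=> yk; rewrite /f1; case: ifP => // _; rewrite addrowE.
  have f1r : (rows f1 k m :=: rows f k m)%MS.
    rewrite /f1; case: ifP => // _; apply: eqmx_trans H2; apply: rows_addrow; lia.
  pose l1 := if f' k j then l' else n.
  exists (addrow n f1 y0 k, [:: k; m; y0 + 1; j; n; c; w; b; s; a; d; u], L).
    exists (addrow n f1 y0 k), n; split; first by rewrite E1.
    have e1 y : y != y0 -> addrow n f1 y0 k y = f1 y by exact: addrowE.
    split=> [y yy|||y yy fy].
    - have yy0 : y != y0 by rewrite /y0 in y0m *; lia.
      rewrite e1 // f1y; last by rewrite /y0 in y0m *; lia.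
      by apply: H1; case: yy => ?; [left|right; lia].
    - by apply: eqmx_trans f1r; apply: rows_addrow; lia.
    - move=> y yy; have [->|ne] := eqVneq y y0.
        by rewrite addrow_eq // f1k f1y // f''f.
      by rewrite e1 // f1y; [apply: H3; rewrite /y0 in ne *|]; lia.
    - by rewrite e1 // eq_sym.
  apply: det_le (det_seq (t1 := 8 * n + 9) (t2 := 1)
    (s1 := (addrow n f1 y0 k, [:: k; m; y0; j; n; c; w; b; s; a; d; u], L)) _ _) _; [| |lia].
    apply: det_le (det_if (t := 8 * n + 8) _) _; last lia.
    rewrite (@eval_ent _ _ _ _ _ _ _ y0 j) ?eval_rg //; last lia.
    rewrite f''f /=; apply: det_le (det_seq (t1 := n * 4 + 4) (t2 := n * 4 + 3)
      (s1 := (f1, [:: k; m; y0; j; l1; c; w; b; s; a; d; u], L)) _ _) _; last lia.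
      apply: det_le (det_if (t := n * 4 + 3) _) _; last lia.
      rewrite (@eval_ent _ _ _ _ _ _ _ k j) ?eval_rg //; last lia.
      rewrite /f1 /l1; case: (f' k j) => /=.
        by apply: det_le (det_skip _ _ _ _) _; lia.
      apply: (@det_add_row R _ _ _ W_large _ _ k y0) => //; try lia.
        by move=> ? ?; rewrite eval_rg.
      by move=> ? ?; rewrite eval_rg.
    apply: (@det_add_row R _ _ _ W_large _ _ y0 k) => //; try lia.
      by move=> ? ?; rewrite eval_rg.
    by move=> ? ?; rewrite eval_rg.
  by apply: det_incr => //=; lia.
- by rewrite evalB !eval_rg //= (_ : k + 1 + _ = m) ?ltnn //; lia.
- exists f, l; rewrite addn0; split=> //; split=> // y yy; first lia.
  by have -> : y = k by lia.
have E : k + 1 + (m - k - 1) = m by lia.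
rewrite E in H1 H3 H4 D; exists f', l'; split=> //.
- have := leq_mul2r (8 * n + 12) (m - k - 1) (m - k).
  rewrite (_ : m - k - 1 <= m - k) ?orbT; last lia.
  move=> le; apply: det_le (det_seq (t1 := 1) _ D) _; last lia.
  by apply: (set_reg (q := 2) (v := k + 1)) => //; [rewrite evalB eval_rg|lia].
- by move=> y yk; apply: H1; left.
- by case: exy => y ym fy; apply: (H4 y).
Qed.

End Elimination.

(** * Survival probabilities *)

(* [surv c s / surv c d] bounds from below the probability that a lightest vector
   survives from rank [d] to rank [s]: each step has factor 1/3 at small ranks
   and ((u - 1) / u)^4, with u = d - c - 3, at large ones. *)
Definition surv c i := 3 ^ (minn i (c + 4)) * (maxn 1 (i - (c + 3))) ^ 4.

Lemma surv_gt0 c i : 0 < surv c i.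
Proof. by rewrite muln_gt0 !expn_gt0 /= leq_max. Qed.

(* For large [i] this is (u + 3) (u - 1)^3 <= u^4 with u = i - c - 3. *)
Lemma surv_step c i N g : 1 < i -> 3 * g <= 2 * N -> (i - c) * g <= 4 * N ->
  surv c i.-1 * N <= surv c i * (N - g).
Proof.
(* Up to c + 4 only the power of 3 changes, and N <= 3(N - g) is the hypothesis 3g <= 2N. *)
move=> i1 g3 gi; rewrite /surv; have [ic|ic] := leqP i (c + 4).
  rewrite (_ : minn i.-1 (c + 4) = i.-1); last lia.
  have -> : maxn 1 (i.-1 - (c + 3)) = 1 by lia.
  have -> : maxn 1 (i - (c + 3)) = 1 by lia.
  rewrite exp1n !muln1 -{2}(prednK (ltnW i1)) expnS (mulnC 3) -mulnA leq_mul2l.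
  by apply/orP; right; lia.
(* Then u = p + 2, the two maxima are p + 1 and p + 2, and the weight bound reads (p + 5)g <= 4N. *)
have [p pE] : exists p, i = p.+1 + c.+4 by exists (i - c - 5); lia.
rewrite (_ : minn i.-1 (c + 4) = c + 4); last lia.
have -> : maxn 1 (i.-1 - (c + 3)) = p.+1 by lia.
have -> : maxn 1 (i - (c + 3)) = p.+2 by lia.
rewrite -(mulnA _ _ N) -(mulnA _ _ (N - g)) leq_mul2l; apply/orP; right.
have gp : (p + 5) * g <= 4 * N by have <- : i - c = p + 5 by lia.
have gN : g <= N by lia.
rewrite mulnBr leq_subRL ?leq_mul2l ?gN ?orbT // addnC.
rewrite -(@leq_pmul2l (p + 5)); last lia.
have gA : p.+2 ^ 4 * ((p + 5) * g) <= p.+2 ^ 4 * (4 * N) by rewrite leq_mul2l gp orbT.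
have AB : (p + 5) * p.+1 ^ 4 + p.+2 ^ 4 * 4 <= (p + 5) * p.+2 ^ 4.
  have -> : (p + 5) * p.+2 ^ 4 = (p + 5) * p.+1 ^ 4 + p.+2 ^ 4 * 4 +
      (6 * p.+1 ^ 3 + 4 * p.+1 ^ 2 + p.+1).
    by rewrite -[p.+2]addn1 -[p.+1]addn1; ring.
  exact: leq_addr.
move: (p.+2 ^ 4) (p.+1 ^ 4) gA AB => A B gA AB.
apply: (@leq_trans (((p + 5) * B + A * 4) * N)); last by rewrite mulnA leq_mul2r AB orbT.
rewrite (_ : (_ + A * 4) * N = (p + 5) * (B * N) + A * (4 * N)); last by ring.
by rewrite mulnDr leq_add2l mulnCA.
Qed.

Lemma eqmx_rows_le n (f f' : bitmx) k' k m : (k' <= k <= m)%N ->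
  (forall i, (i < k)%N -> f' i = f i) -> (rows n f' k m :=: rows n f k m)%MS ->
  (rows n f' k' m :=: rows n f k' m)%MS.
Proof.
move=> km ff E; have [d dE] : exists d, (k' + d)%N = k by exists (k - k')%N; lia.
elim: d k' km dE => [|d IH] k' km dE; first by rewrite addn0 in dE; rewrite dE.
apply: eqmx_rows_S; first lia.
  by apply: eq_rowv => j _; rewrite ff //; lia.
by apply: IH; lia.
Qed.

Section Survival.
Variables (R : realType) (n s0 c : nat) (x : 'rV['F_2]_n) (y z : R).
Local Open Scope ring_scope.
Hypotheses (s0_gt0 : (0 < s0)%N) (x_neq0 : x != 0) (le_zy : z <= y).

Definition gain d : R := (surv c s0)%:R / (surv c d)%:R.

Lemma gain_s0 : gain s0 = 1.
Proof. by rewrite /gain divff // pnatr_eq0 -lt0n surv_gt0. Qed.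

(* A lower bound for the expectation of [y] or [z], according to whether [x]
   survives until the rank is at most [s0]. *)
Definition expected m (V : 'M['F_2]_(m, n)) d : R :=
  z + (y - z) * (if (x <= V)%MS then gain d else 0).

(** [x] survives exactly for the columns outside its support, which are [wt x] fewer than all
    nonzero columns; [surv_step] compares this loss with the growth of [gain]. *)
Lemma expected_contr m (V : 'M['F_2]_(m, n)) t : c = (2 ^ t.+1 + t)%N ->
  perturbed_graphic t V ->
  (forall v : 'rV_n, (v <= V)%MS -> v != 0 -> (wt x <= wt v)%N) ->
  (s0 < \rank V)%N ->
  expected V (\rank V) * #|nzcols V|%:R <=
  \sum_(e in nzcols V) expected (contr V e) (\rank V).-1.
Proof.
move=> cE pg gmin sV.
rewrite /expected; under eq_bigr do rewrite sub_contr.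
have [xV|xV] /= := boolP (x <= V)%MS; last first.
  by rewrite mulr0 addr0 sumr_const mulr_natr.
rewrite big_split /= -mulr_sumr sumr_const -[z *+ _]mulr_natr mulrDl lerD2l.
rewrite -mulrA; apply: ler_wpM2l; first by rewrite subr_ge0.
rewrite -big_mkcondr /= sumr_const -[X in _ <= X]mulr_natr.
have cardE : (#|[pred e | (e \in nzcols V) && (x 0%R e == 0%R)]| = #|nzcols V| - wt x)%N.
  have sx : [set e | x 0 e != 0] \subset nzcols V.
    by apply/subsetP => e; rewrite inE; apply: nzcols_mem.
  rewrite /wt -(setIidPr sx) -cardsD; apply: eq_card => e.
  by rewrite !inE negbK andbC.
rewrite (_ : #|_| = #|nzcols V| - wt x)%N; last exact: cardE.
have H : (surv c (\rank V).-1 * #|nzcols V| <= surv c (\rank V) * (#|nzcols V| - wt x))%N.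
  apply: surv_step; first lia.
    exact: (three_wt_le gmin xV x_neq0 (leq_ltn_trans s0_gt0 sV)).
  by rewrite cE; apply: min_wt_le pg gmin.
rewrite /gain -!mulrA; apply: ler_wpM2l => //.
rewrite ler_pdivrMl ?ltr0n ?surv_gt0 // mulrCA ler_pdivlMl ?ltr0n ?surv_gt0 //.
by rewrite -!natrM ler_nat.
Qed.

(* Once the rank is at most [s0], the rows that decide between [y] and [z] no
   longer change. *)
Definition value (f : bitmx) k m : R :=
  let d := \rank (rows n f k m) in
  if (d <= s0)%N then (if (x <= rows n f (k + d - s0) m)%MS then y else z)
  else expected (rows n f k m) d.

(** A pivot raises [k] and lowers the rank by one, so [k + d] is invariant and the deciding rows
    keep their span. When the rank reaches [s0] they start at the current row and [gain] is 1, so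
    both branches of [value] agree. *)
Lemma value_step (f f' : bitmx) k m e : (k < m)%N ->
  (forall i, (i < k)%N -> f' i = f i) -> (rows n f' k m :=: rows n f k m)%MS ->
  e \in nzcols (rows n f k m) -> (rows n f' k.+1 m :=: contr (rows n f k m) e)%MS ->
  value f' k.+1 m = if (\rank (rows n f k m) <= s0)%N then value f k m
    else expected (contr (rows n f k m) e) (\rank (rows n f k m)).-1.
Proof.
move=> km ff E eN Ec; rewrite /value.
rewrite Ec (rank_contr eN) /=; set d := \rank (contr _ e).
have [ds|ds] := leqP d.+1 s0.
  rewrite ifT; last lia.
  rewrite addSnnS (eqmx_rows_le (f := f) (k := k)) //; lia.
have [ds'|ds'] := leqP d s0.
  have dE : d = s0 by lia.
  rewrite dE addnK Ec /expected gain_s0; case: ifP => _; rewrite ?mulr1 ?mulr0 ?addr0 //.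
  by rewrite addrC subrK.
by rewrite /expected Ec.
Qed.

Lemma value_avg (f : bitmx) k m t : c = (2 ^ t.+1 + t)%N ->
  perturbed_graphic t (rows n f k m) ->
  (forall v : 'rV_n, (v <= rows n f k m)%MS -> v != 0 -> (wt x <= wt v)%N) ->
  value f k m * #|nzcols (rows n f k m)|%:R <= \sum_(e in nzcols (rows n f k m))
    (if (\rank (rows n f k m) <= s0)%N then value f k m
     else expected (contr (rows n f k m) e) (\rank (rows n f k m)).-1).
Proof.
move=> cE pg gmin; rewrite {1}/value; case: leqP => ds /=.
  by rewrite sumr_const mulr_natr /value ds.
exact: expected_contr cE pg gmin ds.
Qed.

Lemma value_end (f : bitmx) k m : rows n f k m = 0 ->
  value f k m = if (x <= rows n f (k - s0) m)%MS then y else z.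
Proof. by move=> r0; rewrite /value r0 mxrank0 addn0. Qed.

(** If the rank starts at or below [s0], [gain] may exceed 1 although survival is merely certain;
    hence the minimum. *)
Lemma value_start (f : bitmx) k m : z + (y - z) *
  (if (x <= rows n f k m)%MS then Num.min 1 (gain (\rank (rows n f k m))) else 0) <= value f k m.
Proof.
rewrite /value; case: leqP => ds; last first.
  rewrite lerD2l; apply: ler_wpM2l; first by rewrite subr_ge0.
  by case: ifP => // _; rewrite ge_min lexx orbT.
case: ifP => xk; last by rewrite mulr0 addr0; case: ifP; rewrite ?lexx.
rewrite ifT; last by apply: submx_trans xk _; apply: rows_anti; lia.
rewrite -lerBrDl; apply: ler_piMr; first by rewrite subr_ge0.
by rewrite ge_min lexx.
Qed.

End Survival.

(** * One random pivot *)

Section EliminationSpec.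
Variables (R : realType) (W r n t s0 : nat) (x : 'rV['F_2]_n) (y z : R).
Hypothesis W_large : base r n + 12 + n + r + 2 < W.
Hypotheses (s0_gt0 : 0 < s0) (x_neq0 : x != 0%R) (le_zy : (z <= y)%R).

Local Notation mem := (memory_of r n).
Local Notation wpe := (@wpe R W _ mem).
Local Notation det := (@det R W _ mem).
Local Notation rows := (rows n).
Local Notation set_reg := (@det_set R W r n W_large).
Let c := 2 ^ t.+1 + t.
Local Notation value := (value s0 c x y z).

(** The count left in register 5 guards the elimination loop: 0 if the remaining rows vanish,
    positive after a pivot. *)
Variant pivot_spec f k m w : bitmx -> nat -> nat -> nat -> Prop :=
| PivotEnd : rows f k m = 0%R -> pivot_spec f k m w f k 0 w
| PivotStep f' cnt e of k < m & 0 < cnt & (forall i, i < k -> f' i = f i) &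
    (rows f' k m :=: rows f k m)%MS & e \in nzcols (rows f k m) &
    (rows f' k.+1 m :=: contr (rows f k m) e)%MS :
    pivot_spec f k m w f' k.+1 cnt #|nzcols (rows f k m)|.

Definition pivot_post f k m w b s a d (st : mstate) := exists f' k' i j l c w' u L,
  st = (f', [:: k'; m; i; j; l; c; w'; b; s; a; d; u], L) /\
  pivot_spec f k m w f' k' c w'.

Definition minimal_in p (V : 'M['F_2]_(p, n)) :=
  forall v : 'rV_n, (v <= V)%MS -> v != 0%R -> wt x <= wt v.

Definition state_value m (st : mstate) := value st.1.1 (nth 0 st.1.2 0) m.

(** A uniform index into the list is a uniform nonzero column. What follows the draw is
    deterministic and leads to the contraction by that column, so the claim reduces to
    [value_avg]. *)
Lemma wpe_pivot_body f k m i l w b s a d u L : k <= m <= r ->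
  perturbed_graphic t (rows f k m) -> minimal_in (rows f k m) ->
  0 < size (cols n f k m) ->
  (forall q, q < size (cols n f k m) -> L q = nth 0 (cols n f k m) q) ->
  wpe pivot_body
    (f, [:: k; m; i; n; l; size (cols n f k m); w; b; s; a; d; u], L)
    ((m - k) * (8 * n + 12) + 11) (pivot_post f k m w b s a d) (state_value m) (value f k m).
Proof.
move=> km pg gmin; set C := size _ => C_gt0 HL.
set V := rows f k m in pg gmin *.
(* The value after pivoting on column [j]; the default 0 is never met, as listed columns are less
   than [n]. *)
pose G j : R := if insub j is Some e then (if \rank V <= s0 then value f k m
  else expected s0 c x y z (contr V e) (\rank V).-1)%N else 0%R.
pose s_ v : mstate := (f, [:: k; m; i; n; l; C; C; b; s; a; d; v], L).
pose P1 st := exists2 v, v < C & st = s_ v.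
pose F1 (st : mstate) := G (nth 0 (cols n f k m) (nth 0 st.1.2 11)).
have Cn : C <= n by exact: size_cols.
have CE : C = #|nzcols V| by exact: size_cols_nzcols.
have D1 : det (Store (reg 6) (rg 5))
    (f, [:: k; m; i; n; l; C; w; b; s; a; d; u], L) 1 (s_ u).
  by apply: (set_reg (q := 6) (v := C)) => //; [rewrite eval_rg|lia].
have H2 : wpe (Draw (reg 11) (Bin Defs.Sub (rg 5) (Const 1))) (s_ u) 1 P1 F1
    ((\sum_(v <- iota 0 C.-1.+1) F1 (s_ v)) / C.-1.+1%:R)%R.
  apply: (@wpe_draw R W _ mem _ _ _ (base r n + 11) C.-1 s_).
  - by rewrite /reg evalB eval_baseE.
  - by rewrite evalB eval_rg //= subn1.
  - lia.
  - lia.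
  move=> v vC; split; last by exists v => //; lia.
  exact: update_reg.
have H3 st1 : P1 st1 -> wpe (Seq (Store (reg 3) (Read (lstA (rg 11)))) (Seq clear_col (incr 0)))
    st1 ((m - k) * (8 * n + 12) + 7) (pivot_post f k m w b s a d) (state_value m) (F1 st1).
  case=> v vC ->.
  set j := nth 0 (cols n f k m) v.
  have jc : j \in cols n f k m by exact: mem_nth.
  have jn : j < n by exact: cols_lt jc.
  pose e := Ordinal jn.
  have eN : e \in nzcols V.
    by move: jc; rewrite -cols_nzcols => /mapP [e' + je]; rewrite mem_enum (_ : e' = e) //; apply: val_inj.
  have exi : exists2 i', k <= i' < m & f i' j.
    move: eN; rewrite nzcols_rows => /existsP [i' /andP [ki fi]].
    by exists i' => //; rewrite ki ltn_ord.
  have km' : k < m <= r by case: exi => i' ? _; lia.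
  have [f' [l' [D2 H1 H2' H3 H4]]] := @det_clear_col R W r n W_large f k m i j l C C b s a d v L km' jn exi.
  have rc : (rows f' k.+1 m :=: contr V e)%MS.
    apply: eqmx_trans (rows_pivot (j := e) _ H3 H4) _; first by case/andP: km'.
    by apply: cap_eqmx.
  have D3 : det (Seq (Store (reg 3) (Read (lstA (rg 11)))) (Seq clear_col (incr 0))) (s_ v)
      ((m - k) * (8 * n + 12) + 7) (f', [:: k + 1; m; m; j; l'; C; C; b; s; a; d; v], L).
    apply: det_le (det_seq (t1 := 1) _ (det_seq (t2 := 1) D2 _)) _; last lia.
      by apply: (set_reg (q := 3) (v := j)) => //; [rewrite (eval_lst (q := v)) ?eval_rg ?HL|lia].
    by apply: (@det_incr R W r n W_large 0) => //=; lia.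
  apply: wpe_det D3 _ _.
    exists f', k.+1, m, j, l', C, C, v, L; split; first by rewrite addn1.
    by rewrite {2}CE; apply: (@PivotStep _ _ _ _ f' C e) => //; case/andP: km'.
  rewrite /state_value /= addn1 (value_step _ s0_gt0 x_neq0 le_zy _ H1 H2' eN rc).
    by rewrite /F1 /= -/j /G insubT //= (_ : Sub j jn = e).
  by case/andP: km'.
apply: wpe_conseq (wpe_det_seq D1 (wpe_seq H2 H3)) _ _ (fun s' Ps => conj Ps (lexx _)).
  lia.
rewrite prednK // ler_pdivlMr ?ltr0n // CE.
apply: le_trans (value_avg s0_gt0 x_neq0 le_zy (erefl _) pg gmin) _.
have -> : (\sum_(v <- iota 0 #|nzcols V|) F1 (s_ v) = \sum_(j <- cols n f k m) G j)%R.
  by rewrite [RHS](big_nth 0) /index_iota subn0 size_cols_nzcols.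
rewrite -cols_nzcols big_map big_enum /=; apply: ler_sum => e _.
by rewrite /G valK.
Qed.

Lemma wpe_pivot_step f k m i j l cn w b s a d u L : k <= m <= r ->
  perturbed_graphic t (rows f k m) -> minimal_in (rows f k m) ->
  wpe pivot_step (f, [:: k; m; i; j; l; cn; w; b; s; a; d; u], L)
    (18 * (n.+1 * (m - k).+1)) (pivot_post f k m w b s a d) (state_value m) (value f k m).
Proof.
move=> km pg gmin.
have [i' [u' [L' [D1 HL]]]] := @det_list_cols R W r n W_large f k m i j l cn w b s a d u L km.
have H2 : wpe (If (rg 5) pivot_body Skip)
    (f, [:: k; m; i'; n; l; size (cols n f k m); w; b; s; a; d; u'], L')
    ((m - k) * (8 * n + 12) + 12) (pivot_post f k m w b s a d) (state_value m) (value f k m).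
  have [C0|C_gt0] := posnP (size (cols n f k m)).
    apply: (@wpe_det _ _ _ _ _ _ _ (f, [:: k; m; i'; n; l; size (cols n f k m); w; b; s; a; d; u'], L')
      _ _ _ (det_le (det_if (t := 1) _) _) _ (lexx _)).
    - by rewrite eval_rg //= C0; apply: det_skip.
    - by apply: leq_trans (leq_addl _ _).
    exists f, k, i', n, l, (size (cols n f k m)), w, u', L'; split=> //.
    rewrite C0; apply: PivotEnd.
    apply/matrixP => p q; rewrite [RHS]mxE; apply/eqP/negbNE/negP => Vpq.
    have : q \in nzcols (rows f k m) by apply/nzcolsP; exists p.
    by move: C0; rewrite size_cols_nzcols => /eqP; rewrite cards_eq0 => /eqP ->; rewrite in_set0.
  rewrite [_ + 12]addnS.
  by apply: wpe_if; rewrite eval_rg //= -lt0n C_gt0; apply: wpe_pivot_body.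
apply: wpe_conseq (wpe_det_seq D1 H2) _ (lexx _) (fun s' Ps => conj Ps (lexx _)).
by move: (m - k) => N; nia.
Qed.

End EliminationSpec.

(** * A complete elimination *)

Lemma nzcols_rV n (v : 'rV['F_2]_n) : #|nzcols v| = wt v.
Proof.
apply: eq_card => e; apply/nzcolsP/idP => [[i]|]; rewrite inE ?ord1 //.
by exists 0%R.
Qed.

Lemma nzcols_eqmx m1 m2 n (V : 'M['F_2]_(m1, n)) (V' : 'M_(m2, n)) :
  (V :=: V')%MS -> nzcols V = nzcols V'.
Proof. by move=> E; apply/eqP; rewrite eqEsubset !nzcols_sub ?E. Qed.

Lemma rows_last n f k m : (k < m) -> rows n f k.+1 m = 0%R ->
  (rows n f k m :=: rowv n f k)%MS.
Proof. by move=> km r0; apply: eqmx_trans (rows_S n f km) _; rewrite r0; apply: addsmx0. Qed.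

Section EliminationLoop.
Variables (R : realType) (W r n t s0 : nat) (x : 'rV['F_2]_n) (y z : R).
Hypothesis W_large : base r n + 12 + n + r + 2 < W.
Hypotheses (s0_gt0 : 0 < s0) (x_neq0 : x != 0%R) (le_zy : (z <= y)%R).

Local Notation mem := (memory_of r n).
Local Notation wpe := (@wpe R W _ mem).
Local Notation det := (@det R W _ mem).
Local Notation rows := (rows n).
Local Notation set_reg := (@det_set R W r n W_large).
Let c := 2 ^ t.+1 + t.
Local Notation value := (value s0 c x y z).
Local Notation state_value := (state_value t s0 x y z).
Local Notation minimal_in := (minimal_in x).

(** [elim_rows] lets a later elimination restart at any row [i]: from there on the rows have full
    rank and still span a perturbed graphic space. *)
Record elim_spec f k m w (f' : bitmx) p w' : Prop := ElimSpec {
  elim_le : k <= p <= m;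
  elim_fix : forall i, i < k -> f' i = f i;
  elim_span : (rows f' k m :=: rows f k m)%MS;
  elim_end : rows f' p m = 0%R;
  elim_rows : forall i, k <= i <= p ->
    perturbed_graphic t (rows f' i m) /\ \rank (rows f' i m) = p - i;
  elim_wt : w' = if k < p then wt (rowv n f' p.-1) else w
}.

Definition elim_post f k m w b s a d (st : mstate) := exists f' p i j l w' u L,
  st = (f', [:: p; m; i; j; l; 0; w'; b; s; a; d; u], L) /\
  elim_spec f k m w f' p w'.

Lemma elim_spec_step f k m w f1 e f2 p w' : k < m -> (forall i, i < k -> f1 i = f i) ->
  (rows f1 k m :=: rows f k m)%MS -> e \in nzcols (rows f k m) ->
  (rows f1 k.+1 m :=: contr (rows f k m) e)%MS ->
  perturbed_graphic t (rows f k m) ->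
  elim_spec f1 k.+1 m #|nzcols (rows f k m)| f2 p w' ->
  elim_spec f k m w f2 p w'.
Proof.
move=> km ff1 E1 eN Ec pg [le ff2 E2 end2 rows2 wt2].
have E : (rows f2 k m :=: rows f k m)%MS.
  apply: eqmx_trans E1; apply: (eqmx_rows_le (k := k.+1)) => //; lia.
split=> //; first lia.
- by move=> i ik; rewrite ff2 ?ff1 //; lia.
- move=> i ip; have [ik|ki] := eqVneq i k; last by apply: rows2; lia.
  subst i; split; first exact: perturbed_graphic_eqmx (eqmx_sym E) pg.
  have [|_] := rows2 k.+1; first by rewrite leqnn; case/andP: le.
  rewrite E2 Ec => rE; rewrite E (rank_contr eN) rE; lia.
- rewrite wt2 (_ : k < p); last by case/andP: le.
  (* For the last pivot, row [k] alone spans the remaining space, so the number of nonzero columns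
     is its weight. *)
  case: ifP => // kp; have pE : p = k.+1 by lia.
  rewrite pE /= -nzcols_rV; congr #|pred_of_set _|.
  apply: nzcols_eqmx; apply: eqmx_trans (eqmx_sym E) _.
  by apply: rows_last => //; rewrite -pE.
Qed.

Lemma wpe_elim_loop m b s a d N f k i j l cn w u L : m - k = N -> k <= m <= r ->
  perturbed_graphic t (rows f k m) -> minimal_in (rows f k m) -> cn != 0 ->
  wpe (While (rg 5) pivot_step) (f, [:: k; m; i; j; l; cn; w; b; s; a; d; u], L)
    (20 * (n.+1 * N.+1 ^ 2)) (elim_post f k m w b s a d) (state_value m) (value f k m).
Proof.
elim: N f k i j l cn w u L => [|N IH] f k i j l cn w u L mk km pg gmin cn0.
all: have D := @wpe_pivot_step R W r n t s0 x y z W_large s0_gt0 x_neq0 le_zy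
  f k m i j l cn w b s a d u L km pg gmin.
all: have e0 : eval (mem (f, [:: k; m; i; j; l; cn; w; b; s; a; d; u], L)) (rg 5) != 0
  by rewrite eval_rg.
all: apply: wpe_conseq (wpe_while (t2 := 20 * (n.+1 * (m - k) ^ 2) + 1) e0 D
   (P := elim_post f k m w b s a d) (F := state_value m) _) _
    (lexx _) (fun st' Ps => conj Ps (lexx _)).
- move=> _ [f' [k' [i' [j' [l' [c' [w' [u' [L' [-> []]]]]]]]]]]; last by lia.
  move=> r0; apply: wpe_conseq (wpe_while_end _ _ _) _ (lexx _) (fun st' Ps => conj Ps (lexx _)).
  + by rewrite eval_rg.
  + exists f, k, i', j', l', w, u', L'; split=> //; split=> //; first by lia.
      by move=> q kq; have -> : q = k by [lia]; rewrite r0 mxrank0 subnn -r0.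
    by rewrite ltnn.
  + by rewrite addn1.
- by rewrite mk; nia.
- move=> _ [f' [k' [i' [j' [l' [c' [w' [u' [L' [-> []]]]]]]]]]].
    move=> r0; apply: wpe_conseq (wpe_while_end _ _ _) _ (lexx _) (fun st' Ps => conj Ps (lexx _)).
    + by rewrite eval_rg.
    + exists f, k, i', j', l', w, u', L'; split=> //; split=> //; first by lia.
        by move=> q kq; have -> : q = k by [lia]; rewrite r0 mxrank0 subnn -r0.
      by rewrite ltnn.
    + by rewrite addn1.
  move=> f1 cnt e lt cnt0 ff1 E1 eN Ec.
  apply: wpe_conseq (IH f1 k.+1 i' j' l' cnt #|nzcols (rows f k m)| u' L' _ _ _ _ _) _ (lexx _) _.
  + lia.
  + lia.
  + exact: perturbed_graphic_eqmx (eqmx_sym Ec) (perturbed_graphic_contr e pg).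
  + by move=> v; rewrite Ec => vc; apply: gmin; apply: submx_trans vc (contr_sub _ _).
  + by rewrite -lt0n.
  + by rewrite mk leq_addr.
  + move=> _ [f2 [p [i2 [j2 [l2 [w2 [u2 [L2 [-> sp]]]]]]]]]; split=> //.
    exists f2, p, i2, j2, l2, w2, u2, L2; split=> //.
    exact: elim_spec_step lt ff1 E1 eN Ec pg sp.
- by rewrite mk; nia.
Qed.

Lemma wpe_eliminate m b s a d f k i j l cn w u L : k <= m <= r ->
  perturbed_graphic t (rows f k m) -> minimal_in (rows f k m) ->
  wpe eliminate (f, [:: k; m; i; j; l; cn; w; b; s; a; d; u], L)
    (20 * (n.+1 * (m - k).+1 ^ 2) + 4) (elim_post f k m 0 b s a d) (state_value m) (value f k m).
Proof.
move=> km pg gmin.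
apply: wpe_conseq (wpe_det_seq (t1 := 1) _ (wpe_det_seq (t1 := 1) _
  (@wpe_elim_loop m b s a d (m - k) f k i j l 1 0 u L (erefl _) km pg gmin (erefl _)))) _
  (lexx _) (fun st' Ps => conj Ps (lexx _)).
- by apply: (set_reg (q := 6) (v := 0)) => //; lia.
- by apply: (set_reg (q := 5) (v := 1)) => //; lia.
- lia.
Qed.

End EliminationLoop.

(** * Repeated trials *)

Lemma rows_trunc n f i p m : p <= m -> rows n f p m = 0%R ->
  (rows n f i m :=: rows n f i p)%MS.
Proof.
move=> pm r0; apply/eqmxP/andP; split; last first.
  by apply: rows_sub => q qp; apply: rowv_sub; lia.
apply: rows_sub => q qm; have [qp|pq] := ltnP q p; first by apply: rowv_sub; lia.
have : (rowv n f q <= rows n f p m)%MS by apply: rowv_sub; lia.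
by rewrite r0 => /submx0null ->; apply: sub0mx.
Qed.

Lemma sub_rank1 n (v x : 'rV['F_2]_n) : (x <= v)%MS -> x != 0%R -> x = v.
Proof.
case/sub_rVP => a ->; have [->|] := eqVneq a 0%R; first by rewrite scale0r eqxx.
by rewrite F2_neq0 => /eqP ->; rewrite scale1r.
Qed.

Lemma convex_bounds (R : realType) (z h : R) : (0 <= z <= 1)%R -> (0 <= h <= 1)%R ->
  (z <= 1 - (1 - z) * h <= 1)%R.
Proof. by move=> /andP [z0 z1] /andP [h0 h1]; apply/andP; split; nra. Qed.

Lemma compl_expr_bounds (R : realType) (p : R) N : (0 <= p <= 1)%R ->
  (0 <= (1 - p) ^+ N <= 1)%R.
Proof. by move=> /andP [p0 p1]; rewrite exprn_ge0 ?exprn_ile1 //; lra. Qed.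

(** [e] bounds the survival in the outer run, [h] the failure of all its inner runs, and [z] is what
    the later outer runs achieve. One outer run thus succeeds with probability at least p/2. *)
Lemma convex_gain (R : realType) (z h e p : R) : (z <= 1 -> h <= 2^-1 -> 0 <= p -> p <= e ->
  1 - (1 - z) * (1 - p / 2) <= z + (1 - (1 - z) * h - z) * e)%R.
Proof.
move=> z1 h2 p0 pe.
have H : (p / 2 <= (1 - h) * e)%R by nra.
have -> : (z + (1 - (1 - z) * h - z) * e = 1 - (1 - z) * (1 - (1 - h) * e))%R by ring.
nra.
Qed.

Section Trials.
Variables (R : realType) (W r n t q : nat) (x : 'rV['F_2]_n) (V0 : 'M['F_2]_(q, n)).
Hypothesis W_large : base r n + 12 + n + r + 2 < W.
Hypothesis x_neq0 : x != 0%R.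
Hypothesis x_min : minimal_in x V0.

Local Notation mem := (memory_of r n).
Local Notation wpe := (@wpe R W _ mem).
Local Notation det := (@det R W _ mem).
Local Notation rows := (rows n).
Local Notation set_reg := (@det_set R W r n W_large).
Let c := 2 ^ t.+1 + t.
Local Notation gain := (@gain R).

(** A candidate is always a true weight, so the best value never drops below the minimum; 0 stands
    for no candidate. *)
Definition weight_or0 b := b = 0 \/ exists v : 'rV['F_2]_n, [/\ (v <= V0)%MS, v != 0%R & wt v = b].

Lemma weight_or0_le b : weight_or0 b -> b <= n.
Proof.
case=> [->//|[v [_ _ <-]]]; rewrite /wt -[X in _ <= X]card_ord; exact: max_card.
Qed.

Lemma weight_or0_min b : weight_or0 b -> b = 0 \/ wt x <= b.
Proof. by case=> [|[v [vV v0 <-]]]; [left|right; apply: x_min]. Qed.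

(* [v], except that it is 1 once the minimum weight has been found. *)
Definition or_hit (v : R) (b : nat) : R := if b == wt x then 1%R else v.

Definition hit_value v (st : mstate) : R := or_hit v (nth 0 st.1.2 7).

Record inner_inv m s f b : Prop := InnerInv {
  inner_span : (rows f 0 m :=: V0)%MS;
  inner_graphic : perturbed_graphic t (rows f (m - s) m);
  inner_rank : \rank (rows f (m - s) m) = m - (m - s);
  inner_best : weight_or0 b
}.

Definition inner_post m s f a d (st : mstate) := exists f' k i j l cn w b u L,
  [/\ st = (f', [:: k; m; i; j; l; cn; w; b; s; a; d; u], L),
      inner_inv m s f' b & (rows f' (m - s) m :=: rows f (m - s) m)%MS].

Definition new_best b w := if (b == 0) || (w < b) then w else b.

Lemma det_update_best f k m i j l cn w b s a d u L : w < W ->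
  det update_best (f, [:: k; m; i; j; l; cn; w; b; s; a; d; u], L) 2
    (f, [:: k; m; i; j; l; cn; w; new_best b w; s; a; d; u], L).
Proof.
move=> wW; apply: det_if; rewrite !evalB evalC !eval_rg //=.
rewrite addn_eq0 !eqb0 -negb_or negbK /new_best; case: ifP => _.
  by apply: (set_reg (q := 7) (v := w)) => //; rewrite eval_rg.
exact: det_skip.
Qed.

(** An elimination with final rank 1: if [x] survives, the last row is [x] and its weight is
    recorded. A miss is worth [z], unless the minimum was found before. *)
Lemma wpe_inner_step (z : R) f k m i j l cn w b s a d u L : (z <= 1)%R ->
  0 < s -> m <= r -> s <= r -> d < W -> inner_inv m s f b ->
  wpe inner_step (f, [:: k; m; i; j; l; cn; w; b; s; a; d; u], L)
    (20 * (n.+1 * s.+1 ^ 2) + 12) (inner_post m s f a d.-1) (hit_value z)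
    (or_hit (z + (1 - z) * (if (x <= rows f (m - s) m)%MS
       then Num.min 1 (gain 1 c (m - (m - s))) else 0))%R b).
Proof.
move=> z_le1 s0 mr sr dW [span pg rk bok].
pose z0 := or_hit z b; have z0_le1 : (z0 <= 1)%R by rewrite /z0 /or_hit; case: ifP.
have gmin : minimal_in x (rows f (m - s) m).
  by move=> v vV; apply: x_min; rewrite -span; apply: submx_trans vV _; apply: rows_anti.
have km : m - s <= m <= r by rewrite leq_subr.
have D1 : det (Store (reg 0) (Bin Defs.Sub (rg 1) (rg 8)))
    (f, [:: k; m; i; j; l; cn; w; b; s; a; d; u], L) 1
    (f, [:: m - s; m; i; j; l; cn; w; b; s; a; d; u], L).
  by apply: (set_reg (q := 0) (v := m - s)) => //; [rewrite evalB !eval_rg|lia].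
have E1 := @wpe_eliminate R W r n t 1 x 1%R z0 W_large isT x_neq0 z0_le1
  m b s a d f (m - s) i j l cn w u L km pg gmin.
apply: wpe_conseq (wpe_det_seq D1 (wpe_seq (t2 := 4) (P := inner_post m s f a d.-1) (F := hit_value z) E1 _)) _ _
  (fun st Ps => conj Ps (lexx _)); first last.
- have := value_start c (ltn0Sn 0) x_neq0 z0_le1 f (m - s) m; rewrite rk.
  apply: le_trans; rewrite /z0 /or_hit; case: ifP => // _.
  by rewrite subrr mul0r addr0.
- have : m - (m - s) <= s by lia.
  move: (m - (m - s)) => e es; have : e.+1 ^ 2 <= s.+1 ^ 2 by rewrite leq_exp2r.
  nia.
move=> _ [f' [p [i' [j' [l' [w' [u' [L' [-> [le fix_ span' end' rows' wt']]]]]]]]]].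
have span0 : (rows f' 0 m :=: V0)%MS.
  by apply: eqmx_trans span; apply: (eqmx_rows_le (k := m - s)) => //; lia.
have [kp pm] := andP le.
have rk' : \rank (rows f' (m - s) m) = p - (m - s).
  by case: (rows' (m - s)); rewrite ?leqnn.
(* The last rows were independent and their span is preserved, so the new elimination again stops at
   row [m]. *)
have pE : p = m by rewrite span' rk in rk'; lia.
subst p.
have wV : 0 < m -> [/\ (rowv n f' m.-1 <= V0)%MS, rowv n f' m.-1 != 0%R & w' = wt (rowv n f' m.-1)].
  move=> m0; have sm : m - s < m by lia.
  split; last by rewrite wt' sm.
    by rewrite -span0; apply: rowv_sub; lia.
  have [|_] := rows' m.-1; first by lia.
  rewrite (rows_last (k := m.-1)) ?prednK //.
  by rewrite rank_rV; case: eqP => //; lia.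
have wok : weight_or0 w'.
  have [m0|m0] := posnP m; last by right; have [? ? ->] := wV m0; exists (rowv n f' m.-1).
  by left; rewrite wt' m0.
have wW : w' < W by have := weight_or0_le wok; lia.
have bok' : weight_or0 (new_best b w') by rewrite /new_best; case: ifP.
have D2 : det (Store (reg 10) (Bin Defs.Sub (rg 10) (Const 1)))
  (f', [:: m; m; i'; j'; l'; 0; w'; new_best b w'; s; a; d; u'], L') 1
  (f', [:: m; m; i'; j'; l'; 0; w'; new_best b w'; s; a; d - 1; u'], L').
  by apply: (set_reg (q := 10) (v := d - 1)) => //; [rewrite evalB eval_rg|lia].
apply: wpe_det (det_seq (@det_update_best f' m m i' j' l' 0 w' b s a d u' L' wW) D2) _ _.
  exists f', m, i', j', l', 0, w', (new_best b w'), u', L'; split=> //.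
    by rewrite subn1.
  split=> //.
  exact: perturbed_graphic_eqmx (eqmx_sym span') pg.
rewrite /state_value /hit_value /= (value_end _ _ _ _ _ end').
have x0 : 0 < wt x by rewrite wt_gt0.
have m0w : 0 < m -> wt x <= w' by move=> /wV [vV v0 ->]; apply: x_min.
(* A minimum already found is kept: a smaller weight could only arise with m = 0, where [V0] has no
   nonzero vector. *)
have [bg|bg] := eqVneq b (wt x).
  rewrite /z0 /or_hit bg eqxx if_same; case: ifP => //.
  rewrite /new_best; case: ifP => //; last by rewrite eqxx.
  move=> /orP [/eqP b0|]; first by rewrite b0 in x0.
  have [m0|m0] := posnP m; last by have := m0w m0; lia.
  move: bok; rewrite bg => -[E|[v [vV v0 _]]]; first by rewrite E in x0.
  move: vV; rewrite -span m0 => /mxrankS; rewrite rank_rV v0.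
  by rewrite leqNgt (leq_ltn_trans (rank_leq_row _)).
rewrite /z0 /or_hit (negPf bg); case: ifP => [xr|_]; last by case: ifP.
have m0 : 0 < m.
  case: (posnP m) xr => // ->; move=> /mxrankS; rewrite rank_rV x_neq0.
  by rewrite leqNgt (leq_ltn_trans (rank_leq_row _)).
have [rV r0 wE] := wV m0.
have w'x : w' = wt x.
  rewrite wE; congr wt; apply/esym/sub_rank1 => //.
  move: xr; rewrite subn1 (rows_last (k := m.-1)) ?prednK //; lia.
rewrite ifT // /new_best w'x; have [//|b0] := eqVneq b 0.
have [E|xb] := weight_or0_min bok; first by rewrite E in b0.
by rewrite /= ltn_neqAle (eq_sym (wt x) b) bg xb eqxx.
Qed.

(** The span of the last rows is the same before each run, so the bound [p] applies every time and
    the failures multiply. *)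
Lemma wpe_inner_loop (z p : R) s a m d f k i j l cn w b u L :
  0 < s -> m <= r -> s <= r -> d < W ->
  inner_inv m s f b -> (0 <= p <= 1)%R -> (0 <= z <= 1)%R ->
  (p <= if (x <= rows f (m - s) m)%MS then Num.min 1 (gain 1 c (m - (m - s))) else 0)%R ->
  wpe (While (rg 10) inner_step) (f, [:: k; m; i; j; l; cn; w; b; s; a; d; u], L)
    (d * (20 * (n.+1 * s.+1 ^ 2) + 13) + 1) (inner_post m s f a 0) (hit_value z)
    (or_hit (1 - (1 - z) * (1 - p) ^+ d)%R b).
Proof.
move=> s0 mr sr + + p01 z01.
elim: d f k i j l cn w b u L => [|d IH] f k i j l cn w b u L dW inv px.
  have H : wpe (While (rg 10) inner_step) (f, [:: k; m; i; j; l; cn; w; b; s; a; 0; u], L)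
      1 (inner_post m s f a 0) (hit_value z) (or_hit z b).
    apply: (@wpe_while_end _ _ _ _ _ _ _ _ (hit_value z)); first by rewrite eval_rg.
    by exists f, k, i, j, l, cn, w, b, u, L.
  by apply: wpe_conseq H _ _ (fun st Ps => conj Ps (lexx _)); rewrite // expr0 mulr1 opprB addrC subrK.
(* What the [d] remaining runs achieve, taken as the worth of a miss in the current run. *)
pose z' := (1 - (1 - z) * (1 - p) ^+ d)%R.
have pd01 : (0 <= (1 - p) ^+ d <= 1)%R by exact: compl_expr_bounds.
have z'1 : (z' <= 1)%R by case/andP: (convex_bounds z01 pd01).
have e0 : eval (mem (f, [:: k; m; i; j; l; cn; w; b; s; a; d.+1; u], L)) (rg 10) != 0.
  by rewrite eval_rg.
have step := @wpe_inner_step z' f k m i j l cn w b s a d.+1 u L z'1 s0 mr sr dW inv.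
apply: wpe_conseq (wpe_while (t2 := d * (20 * (n.+1 * s.+1 ^ 2) + 13) + 1)
  (P := inner_post m s f a 0) (F := hit_value z) e0 step _) _ _
  (fun st Ps => conj Ps (lexx _)).
- move=> _ [f' [k' [i' [j' [l' [cn' [w' [b' [u' [L' [-> inv' span]]]]]]]]]]].
  apply: wpe_conseq (IH f' k' i' j' l' cn' w' b' u' L' _ inv' _) _ (lexx _) _ => //.
  + exact: ltnW.
  + by rewrite span.
  + move=> _ [f2 [k2 [i2 [j2 [l2 [cn2 [w2 [b2 [u2 [L2 [-> inv2 span2]]]]]]]]]]].
    split=> //; exists f2, k2, i2, j2, l2, cn2, w2, b2, u2, L2; split=> //.
    exact: eqmx_trans span2 span.
- by clear; lia.
rewrite /or_hit; case: ifP => // _.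
have : (z' + (1 - z') * p <= z' + (1 - z') * (if (x <= rows f (m - s) m)%MS
       then Num.min 1 (gain 1 c (m - (m - s))) else 0))%R.
  by rewrite lerD2l; apply: ler_wpM2l px; rewrite subr_ge0.
apply: le_trans; rewrite exprS /z'.
by rewrite le_eqVlt; apply/orP; left; apply/eqP; ring.
Qed.

Definition outer_post s a (st : mstate) := exists f k m i j l cn w b d u L,
  [/\ st = (f, [:: k; m; i; j; l; cn; w; b; s; a; d; u], L), m <= r,
      (rows f 0 m :=: V0)%MS & weight_or0 b].

Section Outer.
Variables (s K : nat) (p p' : R).
Hypotheses (s_gt0 : 0 < s) (s_le : s <= r) (KW : K * (r * r) < W).
Hypothesis V0_graphic : perturbed_graphic t V0.
Hypotheses (p01 : (0 <= p <= 1)%R) (p'01 : (0 <= p' <= 1)%R).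
Hypothesis p_le : forall d, d <= s -> (p <= gain 1 c d)%R.
Hypothesis p'_le : (p' <= gain s c (\rank V0))%R.
Hypothesis half : ((1 - p) ^+ (K * (r * r)) <= 2^-1)%R.

Definition outer_time :=
  20 * (n.+1 * r.+1 ^ 2) + K * (r * r) * (20 * (n.+1 * s.+1 ^ 2) + 13) + 15.

(** The elimination is analysed with [s0 = s], where [y] is the worth of the inner loop if [x]
    survives and [z0] its worth otherwise; [convex_gain] combines the two. *)
Lemma wpe_outer_step (z : R) f k m i j l cn w b a d u L : (0 <= z <= 1)%R ->
  z = 1%R \/ (x <= V0)%MS -> m <= r -> a < W ->
  (rows f 0 m :=: V0)%MS -> weight_or0 b ->
  wpe (outer_step K) (f, [:: k; m; i; j; l; cn; w; b; s; a; d; u], L)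
    outer_time (outer_post s a.-1) (hit_value z)
    (or_hit (1 - (1 - z) * (1 - p' / 2))%R b).
Proof.
move=> z01 zx mr aW span bok.
pose N := K * (r * r); have NW : N < W := KW.
have halfN : ((1 - p) ^+ N <= 2^-1)%R := half.
pose z0 := or_hit z b; pose y := (1 - (1 - z0) * (1 - p) ^+ N)%R.
have z0_01 : (0 <= z0 <= 1)%R by rewrite /z0 /or_hit; case: ifP => // _; rewrite ler01 lexx.
have pN01 : (0 <= (1 - p) ^+ N <= 1)%R by exact: compl_expr_bounds.
have le_zy : (z0 <= y)%R by case/andP: (convex_bounds z0_01 pN01).
have pg : perturbed_graphic t (rows f 0 m).
  exact: perturbed_graphic_eqmx (eqmx_sym span) V0_graphic.
have gmin : minimal_in x (rows f 0 m) by move=> v; rewrite span; apply: x_min.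
have D1 : det (Store (reg 0) (Const 0)) (f, [:: k; m; i; j; l; cn; w; b; s; a; d; u], L) 1
    (f, [:: 0; m; i; j; l; cn; w; b; s; a; d; u], L).
  by apply: (set_reg (q := 0) (v := 0)) => //; apply: leq_ltn_trans aW.
have E1 := @wpe_eliminate R W r n t s x y z0 W_large s_gt0 x_neq0 le_zy
  m b s a d f 0 i j l cn w u L mr pg gmin.
apply: wpe_conseq (wpe_det_seq D1 (wpe_seq (t2 := N * (20 * (n.+1 * s.+1 ^ 2) + 13) + 7)
  (P := outer_post s a.-1) (F := hit_value z) E1 _)) _ _
  (fun st Ps => conj Ps (lexx _)); first last.
- have := value_start c s_gt0 x_neq0 le_zy f 0 m; apply: le_trans.
  rewrite /y /z0 /or_hit; case: ifP => _; first by rewrite subrr mul0r subr0 subrr mul0r addr0.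
  case: zx => [->|xV]; first by rewrite subrr !mul0r subr0 subrr mul0r addr0.
  rewrite span xV; have : (p' <= Num.min 1 (gain s c (\rank V0)))%R.
    by rewrite le_min p'_le; case/andP: p'01 => _ ->.
  move=> pe.
  apply: convex_gain => //; first by case/andP: z01.
    by case/andP: p'01.
  by rewrite span.
- rewrite subn0 /outer_time -/N; have : m.+1 ^ 2 <= r.+1 ^ 2 by rewrite leq_exp2r.
  move: (m.+1 ^ 2) (r.+1 ^ 2) (N * _) => A B C' AB.
  by have : n.+1 * A <= n.+1 * B; [rewrite leq_mul2l AB orbT | clear; lia].
move=> _ [f' [p0 [i' [j' [l' [w' [u' [L' [-> [le _ span' end' rows' wt']]]]]]]]]].
have p0m : p0 <= m by case/andP: le.
have p0r : p0 <= r by exact: leq_trans mr.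
have D2 : det (Store (reg 1) (rg 0)) (f', [:: p0; m; i'; j'; l'; 0; w'; b; s; a; d; u'], L') 1
    (f', [:: p0; p0; i'; j'; l'; 0; w'; b; s; a; d; u'], L').
  by apply: (set_reg (q := 1) (v := p0)) => //; [rewrite eval_rg|clear -W_large p0r; lia].
have D3 : det (Store (reg 10) (Bin Mul (Const K) (Bin Mul rE rE)))
    (f', [:: p0; p0; i'; j'; l'; 0; w'; b; s; a; d; u'], L') 1
    (f', [:: p0; p0; i'; j'; l'; 0; w'; b; s; a; N; u'], L').
  by apply: (set_reg (q := 10) (v := N)) => //; rewrite !evalB eval_rE.
have tr q' : (rows f' q' m :=: rows f' q' p0)%MS by apply: rows_trunc.
have inv : inner_inv p0 s f' b.
  split=> //.
  - by apply: eqmx_trans (eqmx_sym (tr 0)) _; apply: eqmx_trans span' span.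
  - have [|g _] := rows' (p0 - s); first by rewrite leq_subr.
    exact: perturbed_graphic_eqmx (tr _) g.
  - by have [|_] := rows' (p0 - s); [rewrite leq_subr | rewrite tr].
(* With probability 0 in the case where [x] is lost, one application of [wpe_inner_loop] covers both
   cases. *)
pose p1 := if (x <= rows f' (p0 - s) p0)%MS then p else 0%R.
have p1_01 : (0 <= p1 <= 1)%R by rewrite /p1; case: ifP => // _; rewrite lexx ler01.
have p1_le : (p1 <= if (x <= rows f' (p0 - s) p0)%MS
    then Num.min 1 (gain 1 c (p0 - (p0 - s))) else 0)%R.
  rewrite /p1; case: ifP => // _; rewrite le_min p_le ?andbT; last by clear; lia.
  by case/andP: p01.
have E2 := @wpe_inner_loop z p1 s a p0 N f' p0 i' j' l' 0 w' b u' L' s_gt0 p0r s_le NW inv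
  p1_01 z01 p1_le.
have E3 st : inner_post p0 s f' a 0 st ->
    wpe (Store (reg 9) (Bin Defs.Sub (rg 9) (Const 1))) st 1 (outer_post s a.-1) (hit_value z)
      (hit_value z st).
  case=> f2 [k2 [i2 [j2 [l2 [cn2 [w2 [b2 [u2 [L2 [-> [sp2 _ _ ok2] _]]]]]]]]]].
  have D4 : det (Store (reg 9) (Bin Defs.Sub (rg 9) (Const 1)))
      (f2, [:: k2; p0; i2; j2; l2; cn2; w2; b2; s; a; 0; u2], L2) 1
      (f2, [:: k2; p0; i2; j2; l2; cn2; w2; b2; s; a - 1; 0; u2], L2).
    by apply: (set_reg (q := 9) (v := a - 1)) => //; [rewrite evalB eval_rg|clear -aW; lia].
  apply: wpe_det D4 _ (lexx _).
  by exists f2, k2, p0, i2, j2, l2, cn2, w2, b2, 0, u2, L2; rewrite subn1.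
apply: wpe_conseq (wpe_det_seq D2 (wpe_det_seq D3 (wpe_seq E2 E3))) _ _
  (fun st Ps => conj Ps (lexx _)).
  by rewrite -/N; clear; lia.
rewrite /state_value /= (value_end _ _ _ _ _ end') tr /or_hit /y /z0 /p1 /or_hit.
case: (b == wt x); first by rewrite subrr mul0r subr0 if_same.
by case: ifP => _ //; rewrite subr0 expr1n mulr1 opprB addrC subrK.
Qed.

Lemma wpe_outer_loop (z : R) a f k m i j l cn w b d u L : (0 <= z <= 1)%R ->
  z = 1%R \/ (x <= V0)%MS -> m <= r -> a < W ->
  (rows f 0 m :=: V0)%MS -> weight_or0 b ->
  wpe (While (rg 9) (outer_step K)) (f, [:: k; m; i; j; l; cn; w; b; s; a; d; u], L)
    (a * outer_time.+1 + 1) (outer_post s 0) (hit_value z)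
    (or_hit (1 - (1 - z) * (1 - p' / 2) ^+ a)%R b).
Proof.
move=> z01 zx.
elim: a f k m i j l cn w b d u L => [|a IH] f k m i j l cn w b d u L mr aW span bok.
  have H : wpe (While (rg 9) (outer_step K)) (f, [:: k; m; i; j; l; cn; w; b; s; 0; d; u], L)
      1 (outer_post s 0) (hit_value z) (or_hit z b).
    apply: (@wpe_while_end _ _ _ _ _ _ _ _ (hit_value z)); first by rewrite eval_rg.
    by exists f, k, m, i, j, l, cn, w, b, d, u, L.
  by apply: wpe_conseq H _ _ (fun st Ps => conj Ps (lexx _)); rewrite // expr0 mulr1 opprB addrC subrK.
pose z' := (1 - (1 - z) * (1 - p' / 2) ^+ a)%R.
have pd01 : (0 <= (1 - p' / 2) ^+ a <= 1)%R.
  by apply: compl_expr_bounds; case/andP: p'01 => p0 p1; apply/andP; split; lra.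
have z'01 : (0 <= z' <= 1)%R.
  have /andP [zz' z'1] := convex_bounds z01 pd01.
  by rewrite z'1 andbT (le_trans _ zz') //; case/andP: z01.
have z'x : z' = 1%R \/ (x <= V0)%MS.
  by case: zx => [zE|xV]; [left; rewrite /z' zE subrr mul0r subr0|right].
have e0 : eval (mem (f, [:: k; m; i; j; l; cn; w; b; s; a.+1; d; u], L)) (rg 9) != 0.
  by rewrite eval_rg.
have step := @wpe_outer_step z' f k m i j l cn w b a.+1 d u L z'01 z'x mr aW span bok.
apply: wpe_conseq (wpe_while (t2 := a * outer_time.+1 + 1)
  (P := outer_post s 0) (F := hit_value z) e0 step _) _ _
  (fun st Ps => conj Ps (lexx _)).
- move=> _ [f' [k' [m' [i' [j' [l' [cn' [w' [b' [d' [u' [L' [-> mr' span' ok']]]]]]]]]]]]].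
  by apply: IH => //; apply: ltnW.
- by clear; lia.
rewrite /or_hit; case: ifP => // _; rewrite exprS /z'.
by rewrite le_eqVlt; apply/orP; left; apply/eqP; ring.
Qed.

End Outer.

End Trials.

(** * Decoding the input and initialization *)

Lemma nth_allpairs_mul (S T : Type) (F : S -> T -> nat) s u x0 y0 i j :
  i < size s -> j < size u ->
  nth 0 [seq F x y | x <- s, y <- u] (i * size u + j) = F (nth x0 s i) (nth y0 u j).
Proof.
elim: s i => [|x s IH] [|i] //= si uj; rewrite nth_cat size_map.
  by rewrite mul0n add0n uj (nth_map y0).
rewrite mulSn -addnA ltnNge leq_addr /= addKn; exact: IH.
Qed.

Lemma size_mx_entries r n (A : 'M['F_2]_(r, n)) : size (mx_entries A) = r * n.
Proof. by rewrite size_allpairs !size_enum_ord. Qed.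

Lemma nth_mx_entries r n (A : 'M['F_2]_(r, n)) (i : 'I_r) (j : 'I_n) :
  nth 0 (mx_entries A) (i * n + j) = (A i j != 0%R).
Proof.
have := @nth_allpairs_mul _ _ (fun i j => nat_of_bool (A i j != 0%R)) (enum 'I_r) (enum 'I_n) i j i j.
by rewrite !size_enum_ord !nth_ord_enum => ->.
Qed.

Lemma nth_mx_entries_le1 r n (A : 'M['F_2]_(r, n)) i : nth 0 (mx_entries A) i <= 1.
Proof.
have [lt|ge] := ltnP i (size (mx_entries A)); last by rewrite nth_default.
have /allpairsP [[p q] /= [_ _ ->]] := mem_nth 0 lt; exact: leq_b1.
Qed.

Section Input.
Variables (r n : nat) (A P : 'M['F_2]_(r, n)).

(** One matrix with [2 * r] rows: those of [P] come right after those of [A]. *)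
Definition input_bits : bitmx := fun i j => input_memory A P (2 + (i * n + j)) != 0.

Lemma input_memoryE : input_memory A P = memory_of r n (input_bits, nseq 12 0, fun=> 0).
Proof.
have sz : size ([:: r; n] ++ mx_entries A ++ mx_entries P) = base r n.
  by rewrite /= size_cat !size_mx_entries /base; lia.
apply/funext => b; rewrite /memory_of; case: ifP => [|/negbT]; last first.
  rewrite -leqNgt => ge; rewrite /input_memory nth_default; last by rewrite sz.
  by case: ifP => // _; rewrite nth_nseq if_same.
case: b => [|[|b]] // _; rewrite /input_bits -divn_eq add2n.
have : input_memory A P b.+2 <= 1.
  rewrite /input_memory /= nth_cat; case: ifP => _; exact: nth_mx_entries_le1.
by case: (input_memory A P b.+2) => [|[|]].
Qed.

Lemma input_bits_l (i : 'I_r) (j : 'I_n) : input_bits i j = (A i j != 0%R).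
Proof.
rewrite /input_bits add2n /input_memory /= nth_cat size_mx_entries ifT.
  by rewrite nth_mx_entries eqb0 negbK.
by have := ltn_ord i; have := ltn_ord j; nia.
Qed.

Lemma input_bits_r (i : 'I_r) (j : 'I_n) : input_bits (r + i) j = (P i j != 0%R).
Proof.
rewrite /input_bits add2n /input_memory /= mulnDl -addnA nth_cat size_mx_entries.
by rewrite ltnNge leq_addr /= addKn nth_mx_entries eqb0 negbK.
Qed.

Definition sum_bits q : bitmx := fun i j =>
  if (i < q) && (j < n) then input_bits i j (+) input_bits (r + i) j else input_bits i j.

Lemma rows_sum_bits : rows n (sum_bits r) 0 r = (A + P)%R.
Proof.
apply/matrixP => i j; rewrite !mxE /= /sum_bits !ltn_ord /= input_bits_l input_bits_r.
rewrite -F2_add_neq0; case: eqVneq => [->//|].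
by rewrite F2_neq0 => /eqP ->.
Qed.

End Input.

Lemma isqrt_exists r : exists2 s, s * s <= r & r < s.+1 * s.+1.
Proof.
elim: r => [|r [s le lt]]; first by exists 0.
have [H|H] := ltnP r.+1 (s.+1 * s.+1); first by exists s => //; lia.
by exists s.+1 => //; lia.
Qed.

Section Init.
Variables (R : realType) (W r n : nat) (A P : 'M['F_2]_(r, n)) (K s : nat).
Hypothesis W_large : base r n + 12 + n + r + 2 < W.
Hypothesis KW : K * (r * r) < W.
Hypotheses (s_le : s * s <= r) (s_gt : r < s.+1 * s.+1).

Local Notation mem := (memory_of r n).
Local Notation det := (@det R W _ mem).
Local Notation set_reg := (@det_set R W r n W_large).

Lemma det_init : exists l, det (init K)
  (input_bits A P, nseq 12 0, fun=> 0) (r * (4 * n + 6) + 2 * s + 7)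
  (sum_bits A P r, [:: 0; r; r; 0; l; 0; 0; 0; s; K * (r * r); 0; 0], fun=> 0).
Proof.
pose I q (st : mstate) := exists l,
  st = (sum_bits A P q, [:: 0; 0; q; 0; l; 0; 0; 0; 0; 0; 0; 0], fun=> 0).
have [q st lt [l ->]|st [l ->]||st [l ->] D1] :=
  @det_loop R W _ mem I (Bin Lt (rg 2) rE)
  (Seq (add_row (rg 2) (Bin Add rE (rg 2))) (incr 2)) r (4 * n + 5)
  (input_bits A P, nseq 12 0, fun=> 0).
- rewrite evalB eval_rE eval_rg //= lt; split=> //.
  exists (sum_bits A P q.+1, [:: 0; 0; q + 1; 0; n; 0; 0; 0; 0; 0; 0; 0], fun=> 0).
    by exists n; rewrite addn1.
  apply: det_le (det_seq (t1 := n * 4 + 3) (t2 := 1)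
    (s1 := (addrow n (sum_bits A P q) q (r + q), [:: 0; 0; q; 0; n; 0; 0; 0; 0; 0; 0; 0], fun=> 0)) _ _) _;
    last lia.
    apply: (@det_add_row R _ _ _ W_large _ _ q (r + q)) => //; try lia.
      by move=> ? ?; rewrite eval_rg.
    by move=> ? ?; rewrite evalB eval_rE eval_rg.
  have -> : addrow n (sum_bits A P q) q (r + q) = sum_bits A P q.+1.
    apply/funext => i; apply/funext => j; rewrite /addrow /sum_bits ltnS (leq_eqVlt i q).
    case: (eqVneq i q) => [->|_] //=; case: (j < n); rewrite /= ?andbF // ltnn /=.
    by rewrite ifN // andbT -leqNgt leq_addl.
  by apply: det_incr => //=; lia.
- by rewrite evalB eval_rE eval_rg //= ltnn.
- by exists 0; congr (_, _, _); apply/funext => i; apply/funext => j; rewrite /sum_bits ltn0.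
pose J q (st : mstate) :=
  st = (sum_bits A P r, [:: 0; 0; r; 0; l; 0; 0; 0; q; 0; 0; 0], fun=> 0).
have sr : s <= r by nia.
have [q st' lt ->|st' ->||_ -> D2] :=
  @det_loop R W _ mem J
  (Bin Lt (Bin Mul (Bin Add (rg 8) (Const 1)) (Bin Add (rg 8) (Const 1)))
                (Bin Add rE (Const 1))) (incr 8) s 1
  (sum_bits A P r, [:: 0; 0; r; 0; l; 0; 0; 0; 0; 0; 0; 0], fun=> 0).
- rewrite !evalB !evalC eval_rE eval_rg //= !addn1 ltnS.
  rewrite (_ : q.+1 * q.+1 <= r); last by nia.
  split=> //; exists (sum_bits A P r, [:: 0; 0; r; 0; l; 0; 0; 0; q + 1; 0; 0; 0], fun=> 0).
    by rewrite /J addn1.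
  by apply: det_incr => //=; lia.
- by rewrite !evalB !evalC eval_rE eval_rg //= !addn1 ltnS leqNgt s_gt.
- by [].
exists l.
apply: det_le (det_seq D1 (det_seq D2 (det_seq (t1 := 1) (t2 := 1)
  (s1 := (sum_bits A P r, [:: 0; r; r; 0; l; 0; 0; 0; s; 0; 0; 0], fun=> 0)) _ _))) _; last lia.
  by apply: (set_reg (q := 1) (v := r)) => //; lia.
by apply: (set_reg (q := 9) (v := K * (r * r))) => //; rewrite !evalB eval_rE.
Qed.

End Init.

(** * Correctness and running time *)

Lemma char_vec_support n (v : 'rV['F_2]_n) : char_vec [set e | v 0%R e != 0%R] = v.
Proof.
apply/rowP => e; rewrite !mxE inE; case: eqVneq => [->//|].
by rewrite F2_neq0 => /eqP ->.
Qed.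

Lemma wt_char_vec n (X : {set 'I_n}) : wt (char_vec X) = #|X|.
Proof. by apply: eq_card => e; rewrite !inE !mxE natrF2_neq0. Qed.

Lemma char_vec_eq0 n (X : {set 'I_n}) : (char_vec X == 0%R) = (X == set0).
Proof. by rewrite -cards_eq0 -wt_char_vec -[RHS]negbK -lt0n wt_gt0 negbK. Qed.

Variant cogirth_spec r n (V : 'M['F_2]_(r, n)) : option nat -> Prop :=
| CogirthInfinite of (forall v : 'rV_n, (v <= V)%MS -> v = 0%R) : cogirth_spec V None
| CogirthFinite x of (x <= V)%MS & x != 0%R & minimal_in x V : cogirth_spec V (Some (wt x)).

(** Over GF(2) vectors and their supports correspond, so smallest nonempty cocycles are lightest
    nonzero vectors of the row space. *)
Lemma cogirthP r n (V : 'M['F_2]_(r, n)) : cogirth_spec V (cogirth V).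
Proof.
rewrite /cogirth; case: pickP => [X0 X0P|noX]; last first.
  apply: CogirthInfinite => v vV; apply/eqP; apply: contraT => v0.
  have := noX [set e | v 0%R e != 0%R].
  by rewrite /cocycle char_vec_support vV andbT -char_vec_eq0 char_vec_support v0.
case: arg_minnP => // X /andP [X0' XV] Xmin; rewrite -wt_char_vec.
apply: CogirthFinite => //; first by rewrite char_vec_eq0.
move=> v vV v0; rewrite wt_char_vec -(char_vec_support v) wt_char_vec; apply: Xmin.
by rewrite /cocycle -char_vec_eq0 char_vec_support v0.
Qed.

(** The induction step is (1 - p)(1 + (N + 1)p) <= 1 + Np. It bounds the failure of N runs by 1/(1 +
    Np). *)
Lemma bernoulli_compl (R : realType) (p : R) N : (0 <= p <= 1)%R ->
  ((1 - p) ^+ N * (1 + N%:R * p) <= 1)%R.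
Proof.
move=> p01; elim: N => [|N IH]; first by rewrite expr0 mul0r addr0 mulr1.
have /andP [h0 _] := compl_expr_bounds N p01; have /andP [p0 p1] := p01.
apply: le_trans IH; rewrite exprS -mulrA mulrCA; apply: ler_wpM2l => //.
rewrite -natr1; have : (0 <= N%:R :> R)%R by rewrite ler0n.
move: (N%:R)%R => e e0.
have : (0 <= e * p * p)%R by rewrite !mulr_ge0.
nra.
Qed.

Section SurvivalBounds.
Variable c : nat.
Let M := 3 ^ (c + 4).

Lemma surv_le i m : maxn 1 i <= m -> surv c i <= M * m ^ 4.
Proof.
move=> im; rewrite leq_mul ?leq_exp2l ?geq_minr // leq_exp2r //.
by apply: leq_trans im; lia.
Qed.

Lemma surv_ge i : i.+1 ^ 4 <= (c + 5) ^ 4 * surv c i.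
Proof.
apply: (@leq_trans ((c + 5) ^ 4 * (maxn 1 (i - (c + 3))) ^ 4)); last first.
  by rewrite leq_mul2l leq_pmull ?orbT ?expn_gt0.
rewrite -expnMn leq_exp2r //; move: (leq_maxl 1 (i - (c + 3))) (leq_maxr 1 (i - (c + 3))).
move: (maxn _ _) => u; nia.
Qed.

End SurvivalBounds.

Section Correctness.
Variables (R : realType) (t E : nat).
Let c := 2 ^ t.+1 + t.
Let M := 3 ^ (c + 4).
(** [K2] makes the number of inner runs the inverse of their success bound, so that all fail with
    probability at most 1/2. [K1] makes the expected number of successful outer runs at least [E]
    for the bound used. *)
Let K2 := M.
Let K1 := 2 * M * (c + 5) ^ 4 * E.
Let C := K1 * (176 + 173 * K2) + 12.

Variables (W r n : nat) (A P : 'M['F_2]_(r, n)).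
Hypothesis W_large : base r n + 12 + n + r + 2 < W.
Hypotheses (K1W : K1 * (r * r) < W) (K2W : K2 * (r * r) < W).

Local Notation mem := (memory_of r n).
Local Notation hp := (@halt_prob R W).
Local Notation prog := (cogirth_prog K1 K2).
Let st0 : mstate := (input_bits A P, nseq 12 0, fun=> 0).

(** The two extra steps unfold the outer [Seq] and store the answer in cell 0, where [r] is read
    until then. *)
Lemma halt_prob_prog T (Post : mstate -> Prop) F v (Q : pred memory) :
  @wpe R W _ mem (If nE (Seq (init K1) (While (rg 9) (outer_step K2))) Skip) st0 T Post F v ->
  (forall f xs L, Post (f, xs, L) -> nth 0 xs 7 < W /\
     (F (f, xs, L) <= (Q (update (mem (f, xs, L)) 0 (nth 0 xs 7)))%:R)%R) ->
  (v <= hp T.+2 ([:: prog], input_memory A P) Q)%R.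
Proof.
move=> H HQ; rewrite input_memoryE (@halt_prob_step _ _ _ _ _ _ ([:: If nE (Seq (init K1)
  (While (rg 9) (outer_step K2))) Skip; Store (Const 0) (rg 7)], mem st0)) //.
rewrite -addn1; apply: H => -[[f xs] L] /HQ [lt le].
rewrite (@halt_prob_step _ _ _ _ _ _ ([::], update (mem (f, xs, L)) 0 (nth 0 xs 7))) //.
by rewrite /= eval_rg // lt (leq_ltn_trans _ lt).
Qed.

Lemma halt_prob_trivial (Q : pred memory) : (n == 0) || (r == 0) ->
  (forall m, m 0 = 0 -> Q m) ->
  (1 <= hp (C * (r ^ 5 * n + 1)) ([:: prog], input_memory A P) Q)%R.
Proof.
move=> rn0 HQ.
have H : @wpe R W _ mem (If nE (Seq (init K1) (While (rg 9) (outer_step K2))) Skip) st0 10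
    (fun st => nth 0 st.1.2 7 = 0) (fun=> 1%R) 1%R.
  have [n0|n_gt0] := posnP n.
    have D : @det R W _ mem (If nE (Seq (init K1) (While (rg 9) (outer_step K2))) Skip) st0 2 st0.
      by apply: det_if; rewrite eval_nE n0; apply: det_skip.
    by apply: wpe_det (det_le D _) _ (lexx _).
  have r0 : r = 0 by case/orP: rn0 => /eqP // n0; rewrite n0 in n_gt0.
  have r_lt1 : r < 1 * 1 by rewrite r0.
  have [l D] := @det_init R W r n A P K1 0 W_large K1W (leq0n r) r_lt1.
  apply: (wpe_if (t := 9)); rewrite eval_nE -lt0n n_gt0 /=.
  have H0 : @wpe R W _ mem (While (rg 9) (outer_step K2)) (sum_bits A P r,
      [:: 0; r; r; 0; l; 0; 0; 0; 0; K1 * (r * r); 0; 0], fun=> 0) 1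
      (fun st => nth 0 st.1.2 7 = 0) (fun=> 1%R) 1%R.
    apply: (@wpe_while_end _ _ _ _ _ _ _ _ (fun=> 1%R)) => //.
    by rewrite eval_rg //= r0 !muln0.
  by apply: wpe_conseq (wpe_det_seq D H0) _ (lexx _) (fun st Ps => conj Ps (lexx _)); rewrite r0.
apply: le_trans (halt_prob_prog (Q := Q) H _) _.
  move=> f xs L /= ->; split; first by clear -W_large; lia.
  by rewrite HQ.
apply: halt_prob_le; rewrite /C; clear; nia.
Qed.

(** [z] is the credit for a run that misses the minimum: 1 yields sure termination, 0 the
    probability of a hit. With credit 1 the vector [x] may lie outside the row space, which covers
    infinite cogirth. *)
Lemma halt_prob_hit (x : 'rV['F_2]_n) (z : R) (Q : pred memory) : 0 < r -> 0 < n ->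
  is_incidence_mx A -> \rank P <= t ->
  x != 0%R -> minimal_in x (A + P)%R ->
  (0 <= z <= 1)%R -> z = 1%R \/ (x <= (A + P)%R)%MS ->
  (forall m b, m 0 = b -> weight_or0 (A + P)%R b -> (or_hit x z b <= (Q m)%:R)%R) ->
  (1 - (1 - z) * (1 + E%:R)^-1 <=
     hp (C * (r ^ 5 * n + 1)) ([:: prog], input_memory A P) Q)%R.
Proof.
move=> r_gt0 n_gt0 inc rP x0 xmin z01 zx HQ.
have [s s_le s_gt] := isqrt_exists r.
have s_gt0 : 0 < s by nia.
have sr : s <= r by nia.
have M_gt0 : 0 < M by rewrite expn_gt0.
have rr_gt0 : 0 < r * r by rewrite muln_gt0 r_gt0.
have X_gt0 : 0 < M * (c + 5) ^ 4 * (r * r).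
  have c5_gt0 : 0 < (c + 5) ^ 4 by rewrite expn_gt0 addn_gt0 orbT.
  by rewrite muln_gt0 rr_gt0 andbT muln_gt0 M_gt0.
pose p : R := (M * (r * r))%:R^-1%R.
pose p' : R := (M * (c + 5) ^ 4 * (r * r))%:R^-1%R.
have inv01 N : 0 < N -> (0 <= (N%:R : R)^-1 <= 1)%R.
  by move=> N0; rewrite invr_ge0 ler0n invf_le1 ?ltr0n // ler1n.
have p01 : (0 <= p <= 1)%R by apply: inv01; rewrite muln_gt0 M_gt0.
have p'01 : (0 <= p' <= 1)%R by exact: inv01.
(* [surv c d] is at most M s^4, and s^4 <= r^2. *)
have p_le d : d <= s -> (p <= gain R 1 c d)%R.
  move=> ds; rewrite /gain ler_pdivlMr ?ltr0n ?surv_gt0 // mulrC ler_pdivrMr; last first.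
    by rewrite ltr0n muln_gt0 M_gt0.
  rewrite -natrM ler_nat.
  have H : surv c d <= M * s ^ 4 by apply: surv_le; lia.
  have H2 : s ^ 4 <= r * r by rewrite (_ : s ^ 4 = (s * s) * (s * s)) ?leq_mul //; ring.
  apply: leq_trans H _; apply: leq_trans (leq_pmull _ (surv_gt0 c 1)).
  by rewrite leq_mul2l H2 orbT.
(* [surv] is at most M r^4 at the initial rank, while at [s] it is at least r^2/(c + 5)^4 because r
   < (s + 1)^2. *)
have p'_le : (p' <= gain R s c (\rank (A + P)%R))%R.
  rewrite /gain ler_pdivlMr ?ltr0n ?surv_gt0 // mulrC ler_pdivrMr; last first.
    by rewrite ltr0n.
  rewrite -natrM ler_nat; set d := \rank _.
  have dr : d <= r by exact: rank_leq_row.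
  have H : surv c d <= M * r ^ 4 by apply: surv_le; lia.
  have H1 : r * r <= (c + 5) ^ 4 * surv c s.
    apply: leq_trans (surv_ge c s); rewrite (_ : s.+1 ^ 4 = (s.+1 * s.+1) * (s.+1 * s.+1)).
      by rewrite leq_mul // ltnW.
    by rewrite -[s.+1]addn1; ring.
  apply: leq_trans H _.
  rewrite (_ : r ^ 4 = (r * r) * (r * r)); last by ring.
  rewrite (_ : surv c s * _ = M * ((c + 5) ^ 4 * surv c s * (r * r))); last by ring.
  by rewrite leq_mul2l leq_mul2r H1 !orbT.
have half : ((1 - p) ^+ (K2 * (r * r)) <= 2^-1)%R.
  have := bernoulli_compl (K2 * (r * r)) p01.
  rewrite {2}/p mulfV; last by rewrite pnatr_eq0 -lt0n muln_gt0 M_gt0.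
  lra.
have pg : perturbed_graphic t (A + P)%R by exact: perturbed_graphicD.
have p'h : (0 <= p' / 2 <= 1)%R by case/andP: p'01 => ? ?; apply/andP; split; lra.
have miss : ((1 - p' / 2) ^+ (K1 * (r * r)) <= (1 + E%:R)^-1)%R.
  have := bernoulli_compl (K1 * (r * r)) p'h.
  have -> : ((K1 * (r * r))%:R * (p' / 2) = E%:R :> R)%R.
    rewrite (_ : K1 * (r * r) = E * 2 * (M * (c + 5) ^ 4 * (r * r))); last by rewrite /K1; ring.
    have X0 : ((M * (c + 5) ^ 4 * (r * r))%:R != 0 :> R)%R.
      by rewrite pnatr_eq0 -lt0n.
    rewrite natrM natrM /p'; move: ((M * (c + 5) ^ 4 * (r * r))%:R)%R X0 => X X0.
    by field.
  by rewrite -ler_pdivlMr ?div1r // ltr_pwDl // ler0n.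
have [l D] := @det_init R W r n A P K1 s W_large K1W s_le s_gt.
have okr : rows n (sum_bits A P r) 0 r = (A + P)%R by exact: rows_sum_bits.
have L1 := @wpe_outer_loop R W r n t r x (A + P)%R W_large x0 xmin s K2 p p' s_gt0 sr K2W pg
  p01 p'01 p_le p'_le half z (K1 * (r * r)) (sum_bits A P r) 0 r r 0 l 0 0 0 0 0 (fun=> 0)
  z01 zx (leqnn r) K1W.
rewrite okr in L1; have {}L1 := L1 (eqmx_refl _) (or_introl (erefl 0)).
set tW := (_ * _.+1 + 1) in L1.
have H : @wpe R W _ mem (If nE (Seq (init K1) (While (rg 9) (outer_step K2))) Skip) st0
    (r * (4 * n + 6) + 2 * s + 9 + tW) (outer_post r (A + P)%R s 0) (hit_value x z)
    (1 - (1 - z) * (1 + E%:R)^-1)%R.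
  apply: wpe_conseq (wpe_if (t := (r * (4 * n + 6) + 2 * s + 7 + tW).+1) _) _ (lexx _)
    (fun st Ps => conj Ps (lexx _)); last by clear; lia.
  rewrite eval_nE -lt0n n_gt0 /=.
  apply: wpe_conseq (wpe_det_seq D L1) (leqnn _) _ (fun st Ps => conj Ps (lexx _)).
  (* The initial best value 0 is no hit, as [x] has positive weight. *)
  rewrite /or_hit eq_sym -leqn0 leqNgt wt_gt0 x0 lerD2l lerN2; apply: ler_wpM2l miss.
  by case/andP: z01 => _; rewrite subr_ge0.
apply: le_trans (halt_prob_prog (Q := Q) H _) _.
  move=> f xs L [f' [k [m [i [j [l' [cn [w [b [d [u [L' [[-> -> ->] _ _ ok]]]]]]]]]]]]] /=.
  split; last by apply: HQ ok; rewrite /update eqxx.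
  by have := weight_or0_le ok; clear -W_large; lia.
apply: halt_prob_le; rewrite /tW /outer_time /C.
move: (K1) (K2) => k1 k2; clear -s_le sr r_gt0 n_gt0 s_gt0.
(* An inner run costs O(nr) since s^2 <= r, an outer run with its O(r^2) inner runs O(n r^3), and
   there are O(r^2) outer runs. *)
have e1 : n.+1 <= 2 * n by lia.
have e2 : r.+1 ^ 2 <= 4 * (r * r) by nia.
have e3 : s.+1 ^ 2 <= 4 * r by nia.
have e4 : n.+1 * r.+1 ^ 2 <= 8 * (n * (r * r)).
  by apply: leq_trans (leq_mul e1 e2) _; rewrite leq_eqVlt; apply/orP; left; apply/eqP; ring.
have e5 : n.+1 * s.+1 ^ 2 <= 8 * (n * r).
  by apply: leq_trans (leq_mul e1 e3) _; rewrite leq_eqVlt; apply/orP; left; apply/eqP; ring.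
have nr : 0 < n * r by rewrite muln_gt0 n_gt0.
have e6 : 20 * (n.+1 * s.+1 ^ 2) + 13 <= 173 * (n * r) by lia.
have nr3 : n * (r * r) <= n * r ^ 3.
  by rewrite leq_mul2l (_ : r * r = r ^ 2) // leq_pexp2l ?orbT.
have nr3' : 0 < n * r ^ 3 by rewrite muln_gt0 n_gt0 expn_gt0 r_gt0.
have e7 : k2 * (r * r) * (20 * (n.+1 * s.+1 ^ 2) + 13) <= 173 * k2 * (n * r ^ 3).
  apply: leq_trans (leq_mul (leqnn _) e6) _.
  by rewrite leq_eqVlt; apply/orP; left; apply/eqP; ring.
have e8 : (20 * (n.+1 * r.+1 ^ 2) + k2 * (r * r) * (20 * (n.+1 * s.+1 ^ 2) + 13) + 15).+1
    <= (176 + 173 * k2) * (n * r ^ 3) by rewrite mulnDl; lia.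
have e9 : k1 * (r * r) * (20 * (n.+1 * r.+1 ^ 2) + k2 * (r * r) * (20 * (n.+1 * s.+1 ^ 2) + 13) + 15).+1
    <= k1 * (176 + 173 * k2) * (r ^ 5 * n).
  apply: leq_trans (leq_mul (leqnn _) e8) _.
  by rewrite leq_eqVlt; apply/orP; left; apply/eqP; ring.
have e10 : r * n <= r ^ 5 * n by rewrite leq_mul2r -{1}(expn1 r) leq_pexp2l ?orbT.
have e11 : r <= r * n by rewrite leq_pmulr.
move: e9; set X := k1 * (r * r) * _; set Y := k1 * (176 + _); move: X Y (r ^ 5 * n) e10 => X Y Z e10 XY.
rewrite (_ : r * (4 * n + 6) = 4 * (r * n) + 6 * r); last by ring.
rewrite (_ : (Y + 12) * (Z + 1) = Y * Z + 12 * Z + Y + 12); last by ring.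
by move: e10 e11 sr XY; move: (r * n) (Y * Z) => u v; clear; lia.
Qed.

End Correctness.

Theorem theorem1p2 (R : realType) (t : nat) (eps : R)
    (t_gt0 : 0 < t) (eps_gt0 : (0 < eps)%R) :
  exists (prog : cmd) (k C : nat),
  forall (r n : nat) (A P : 'M['F_2]_(r, n)),
    is_incidence_mx A -> \rank P <= t ->
    let W := (r + n + 2) ^ k in
    let T := C * (r ^ 5 * n + 1) in
    let start : state := ([:: prog], input_memory A P) in
    halt_prob R W T start predT = 1%R /\
    (1 - eps <= halt_prob R W T start
                  (fun m => output m == cogirth (A + P)%R))%R.
Proof.
(* Chosen so that the failure bound 1/(1 + E) is at most [eps]. *)
pose E := Num.bound (eps^-1)%R.
have epsE : ((1 + E%:R)^-1 <= eps)%R.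
  have := archi_boundP (ltW (etrans (invr_gt0 eps) eps_gt0)); rewrite -/E => lt.
  rewrite -[leRHS]invrK lef_pV2 ?posrE ?invr_gt0 ?ltr_pwDl ?ler0n //.
  by apply: le_trans (ltW lt) _; rewrite lerDr.
pose c := 2 ^ t.+1 + t; pose K2 := 3 ^ (c + 4); pose K1 := 2 * K2 * (c + 5) ^ 4 * E.
(* The base of [W] is at least 2, so its power K1 + K2 exceeds K1 + K2; the ten further factors make
   room for the addresses and for r^2. *)
exists (cogirth_prog K1 K2), (K1 + K2 + 10), (K1 * (176 + 173 * K2) + 12).
move=> r n A P inc rP W T start.
have [W_large KW] : base r n + 12 + n + r + 2 < W /\ (K1 + K2) * (r * r) < W.
  rewrite /W; set b := r + n + 2; have b2 : 1 < b by rewrite /b; lia.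
  have b0 : 0 < b by exact: ltnW.
  have powK : K1 + K2 < b ^ (K1 + K2) by exact: ltn_expl.
  have pow8 : 2 ^ 8 <= b ^ 8 by rewrite leq_exp2r.
  have e : b ^ (K1 + K2 + 10) = b ^ (K1 + K2) * (b ^ 8 * (b * b)).
    by rewrite expnD (_ : b ^ 10 = b ^ 8 * (b * b)) //; ring.
  have rb : r * r <= b * b by rewrite leq_mul // /b; lia.
  have bb : 0 < b * b by rewrite muln_gt0 b0.
  have K0 : 0 < b ^ (K1 + K2) by rewrite expn_gt0 b0.
  split.
    rewrite e; apply: (@leq_trans (b ^ 8 * (b * b))); last by rewrite leq_pmull.
    apply: (@leq_trans (2 ^ 8 * (b * b))); last by rewrite leq_mul2r pow8 orbT.
    by rewrite /base /b; lia.
  rewrite e; apply: (@leq_ltn_trans ((K1 + K2) * (b * b))); first by rewrite leq_mul2l rb orbT.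
  apply: (@leq_trans (b ^ (K1 + K2) * (b * b))); first by rewrite ltn_mul2r bb.
  by rewrite leq_mul2l leq_pmull ?orbT // expn_gt0 b0.
have [K1W K2W] : K1 * (r * r) < W /\ K2 * (r * r) < W.
  by move: KW; rewrite mulnDl; clear; lia.
suff [H1 H2] : (1 <= halt_prob R W T start predT)%R /\
    (1 - eps <= halt_prob R W T start (fun m => output m == cogirth (A + P)%R))%R.
  by split=> //; apply/eqP; rewrite eq_le H1 andbT; apply: halt_prob_le1.
have out0 m : m 0 = 0 -> output m = None by rewrite /output => ->.
have none Q : (1 <= halt_prob R W T start Q -> 1 - eps <= halt_prob R W T start Q)%R.
  by apply: le_trans; rewrite lerBlDr lerDl ltW.
have [rn0|] := boolP ((n == 0) || (r == 0)).
  have V0 (v : 'rV['F_2]_n) : (v <= (A + P)%R)%MS -> v = 0%R.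
    case/orP: rn0 => /eqP E0 => [_|/mxrankS].
      by apply/rowP => i; have := ltn_ord i; rewrite {2}E0.
    move/leq_trans/(_ (rank_leq_row _)); rewrite rank_rV E0 leqn0 eqb0 negbK.
    by move/eqP.
  have trivial := @halt_prob_trivial R t E W r n A P W_large K1W _ rn0.
  split; first exact: trivial.
  apply/none/trivial => m m0; rewrite out0 //.
  by case: cogirthP => // x xV; rewrite (V0 x xV) eqxx.
rewrite negb_or -!lt0n => /andP [n_gt0 r_gt0].
have hit x z Q := @halt_prob_hit R t E W r n A P W_large K1W K2W x z Q r_gt0 n_gt0 inc rP.
have one01 : (0 <= (1 : R) <= 1)%R by rewrite ler01 lexx.
have zero01 : (0 <= (0 : R) <= 1)%R by rewrite ler01 lexx.
have or_hit_le1 (x : 'rV['F_2]_n) b : (or_hit x 1%R b <= 1 :> R)%R by rewrite /or_hit if_same.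
case: (cogirthP (A + P)%R) => [V0|x xV x0 xmin].
  (* There is no lightest vector; the all-ones vector stands in for it with credit 1, its minimality
     being vacuous. The best value can only be 0, the code of infinity. *)
  have x0 : const_mx 1%R != 0%R :> 'rV['F_2]_n.
    by apply/rV0Pn; exists (Ordinal n_gt0); rewrite mxE oner_eq0.
  have xmin : minimal_in (const_mx 1%R : 'rV['F_2]_n) (A + P)%R.
    by move=> v /V0 ->; rewrite eqxx.
  have {}hit Q := hit (const_mx 1%R) 1%R Q x0 xmin one01 (or_introl erefl).
  rewrite subrr mul0r subr0 in hit.
  split; first by apply: hit.
  apply/none/hit => m b mb [b0|[v [/V0 -> ]]]; last by rewrite eqxx.
  by rewrite out0 ?mb.
split.
  have := hit x 1%R predT x0 xmin one01 (or_intror xV); rewrite subrr mul0r subr0; exact.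
have {}hit := hit x 0%R (fun m => output m == Some (wt x)) x0 xmin zero01 (or_intror xV).
apply: le_trans (hit _); first by rewrite subr0 mul1r lerD2l lerN2.
move=> m b mb _; rewrite /or_hit; case: eqP => [bx|_]; last exact: ler0n.
by rewrite /output mb bx; case: (wt x) (wt_gt0 x) => [|w _]; rewrite ?x0 ?eqxx.
Qed.
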